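(* Let $\mathcal A=\{n_1,n_2,n_3\}$ be a set of three positive integers with $\gcd(n_1,n_2,n_3)=1$ such that the toric ideal $I_{\mathcal A}$ is not a complete intersection. Then the Markov complexity $m(\mathcal A)$ of $\mathcal A$ is $3$. Moreover, for any $r\ge 3$ we have $\mathcal M(\mathcal A^{(r)})=\mathcal S(\mathcal A^{(r)})$, and the cardinality of $\mathcal M(\mathcal A^{(r)})$ is $k\binom r2+6\binom r3$, where $k$ is the cardinality of the Graver basis of $\mathcal A$.
   Context: $\mathbb N$ contains $0$. For an integer matrix $D$ with $N$ columns and entries in $\mathbb N$ (or the configuration $\mathcal D$ of its columns), let $\mathcal L(\mathcal D)=\operatorname{Ker}_{\mathbb Z}(D)\subset\mathbb Z^N$. For $\mathbf u\in\mathbb Z^N$ write $\mathbf u=\mathbf u^+-\mathbf u^-$ with $\mathbf u^\pm\in\mathbb N^N$ of disjoint supports. The toric ideal $I_{\mathcal D}\subset\Bbbk[x_1,\dots,x_N]$ ($\Bbbk$ a field) is generated by all binomials $x^{\mathbf u}-x^{\mathbf w}$ with $\mathbf u,\mathbf w\in\mathbb N^N$, $\mathbf u-\mathbf w\in\mathcal L(\mathcal D)$. For $\mathcal A=\{n_1,n_2,n_3\}$ the matrix is $A=(n_1\ n_2\ n_3)$, and $I_{\mathcal A}$ is a complete intersection iff it can be generated by $2$ elements. A Markov basis of $\mathcal D$ is a finite subset $\mathcal M\subset\mathcal L(\mathcal D)$ such that for all $\mathbf w,\mathbf u\in\mathbb N^N$ with $\mathbf w-\mathbf u\in\mathcal L(\mathcal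 D)$ there is a finite (possibly empty) sequence $\mathbf v_1,\dots,\mathbf v_s$ with $\mathbf v_i\in\mathcal M$ or $-\mathbf v_i\in\mathcal M$ such that $\mathbf w-\mathbf u=\sum_{i=1}^s\mathbf v_i$ and $\mathbf w-\sum_{i=1}^p\mathbf v_i\in\mathbb N^N$ for all $1\le p\le s$. It is minimal if no proper subset is a Markov basis. The universal Markov basis $\mathcal M(\mathcal D)$ is the union, and the indispensable subset $\mathcal S(\mathcal D)$ the intersection, of all minimal Markov bases of $\mathcal D$. The Graver basis $\mathcal G(\mathcal D)$ is the (finite) set of nonzero $\mathbf u\in\mathcal L(\mathcal D)$ that cannot be written $\mathbf u=\mathbf v+\mathbf w$ with $\mathbf v,\mathbf w\in\mathcal L(\mathcal D)$ nonzero, $\mathbf u^+=\mathbf v^++\mathbf w^+$ and $\mathbf u^-=\mathbf v^-+\mathbf w^-$. In $\mathcal M(\mathcal D)$, $\mathcal S(\mathcal D)$, $\mathcal G(\mathcal D)$, vectors differing only by a sign are identified, and cardinalities are counted with this identification. Lawrence lifting: for $A\in\mathcal M_{m\times n}(\mathbb N)$ and $r\ge 2$, $\mathcal A^{(r)}$ is the $(rm+n)\times rn$ matrix consisting of the block-diagonal matrix with $r$ diagonal blocks $A$, followed below by the row of blocks $(I_n\ I_n\ \cdots\ I_n)$. An element of $\mathcal L(\mathcal A^{(r)})$ is identified with an $r\times n$ integer matrix whose rows lie in $\mathcal L(\mathcal A)$ and sum to zero; its type is the number of its nonzero rows. The Markov complexity $m(\mathcal A)$ is the largest type of any vector in $\mathcal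 M(\mathcal A^{(r)})$ as $r\ge2$ varies. *)

(* Defs.v *)
From mathcomp Require Import all_boot all_order all_algebra finmap.
From mathcomp Require Import boolp classical_sets cardinality.
From mathcomp Require Import mpoly.

Set Implicit Arguments.
Unset Strict Implicit.
Unset Printing Implicit Defensive.

Import Order.TTheory GRing.Theory Num.Theory.
Local Open Scope ring_scope.
Local Open Scope classical_set_scope.
Local Open Scope card_scope.

(* A configuration is given by a matrix D of natural numbers, whose columns are
   the vectors of the configuration; vectors of Z^N are integer columns, and
   those with nonnegative entries play the role of N^N. *)

Definition lattice (m N : nat) (D : 'M[nat]_(m, N)) : set 'cV[int]_N :=
  [set u | map_mx Posz D *m u = 0].

Definition nonneg (N : nat) : set 'cV[int]_N :=
  [set u | u \is a mxOver Num.nneg].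
Arguments nonneg {N}.

Definition pos_part (N : nat) (u : 'cV[int]_N) : 'cV[int]_N :=
  map_mx (fun x => Num.max x 0) u.

Definition neg_part (N : nat) (u : 'cV[int]_N) : 'cV[int]_N :=
  map_mx (fun x => Num.max (- x) 0) u.

Definition ideal_generated (R : comNzRingType) (G : set R) : set R :=
  [set f | exists s : seq (R * R),
     (forall ag, ag \in s -> G ag.2) /\ f = \sum_(ag <- s) ag.1 * ag.2].

Definition toric_ideal (K : fieldType) (m N : nat) (D : 'M[nat]_(m, N)) :
    set {mpoly K[N]} :=
  ideal_generated
    [set f | exists u w : 'X_{1..N},
       lattice D (\col_i ((u i)%:Z - (w i)%:Z)) /\ f = 'X_[u] - 'X_[w]].
Arguments toric_ideal K {m N} D.

(* For three positive integers the toric ideal has height 2, so being a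
   complete intersection means being generated by two elements. *)
Definition complete_intersection3 (K : fieldType) (A : 'M[nat]_(1, 3)) : Prop :=
  exists f g : {mpoly K[3]}, toric_ideal K A = ideal_generated [set f; g].

Definition markov_basis (m N : nat) (D : 'M[nat]_(m, N))
    (M : {fset 'cV[int]_N}) : Prop :=
  [set` M] `<=` lattice D /\
  forall w u : 'cV[int]_N, nonneg w -> nonneg u -> lattice D (w - u) ->
    exists s : seq 'cV[int]_N,
      [/\ forall v, v \in s -> v \in M \/ - v \in M,
          w - u = \sum_(v <- s) v
        & forall p, (1 <= p <= size s)%N ->
            nonneg (w - \sum_(v <- take p s) v)].

Definition minimal_markov_basis (m N : nat) (D : 'M[nat]_(m, N)) :
    set {fset 'cV[int]_N} :=
  [set M | markov_basis D M /\
     forall M' : {fset 'cV[int]_N}, (M' `<` M)%fset -> ~ markov_basis D M'].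

(* Vectors differing only by a sign are identified: a set of classes {v, -v}
   is represented by the union of these classes, i.e. by a subset of Z^N
   closed under negation. *)
Definition sign_closure (T : zmodType) (S : set T) : set T :=
  [set v | S v \/ S (- v)].

(* The number of classes {v, -v} of elements v of S is k. *)
Definition card_up_to_sign (T : zmodType) (S : set T) (k : nat) : Prop :=
  (fun v => [set v; - v]) @` S #= `I_k.

Definition universal_markov (m N : nat) (D : 'M[nat]_(m, N)) :
    set 'cV[int]_N :=
  \bigcup_(M in minimal_markov_basis D) sign_closure [set` M].

Definition indispensable (m N : nat) (D : 'M[nat]_(m, N)) : set 'cV[int]_N :=
  \bigcap_(M in minimal_markov_basis D) sign_closure [set` M].

Definition graver_basis (m N : nat) (D : 'M[nat]_(m, N)) : set 'cV[int]_N :=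
  [set u | [/\ lattice D u, u <> 0
    & ~ exists v w : 'cV[int]_N,
        [/\ lattice D v /\ v <> 0, lattice D w /\ w <> 0, u = v + w,
            pos_part u = pos_part v + pos_part w
          & neg_part u = neg_part v + neg_part w]]].

Definition lawrence (m n : nat) (A : 'M[nat]_(m, n)) (r : nat) :
    'M[nat]_(\sum_(i < r) m + n, \sum_(j < r) n) :=
  col_mx (\mxblock_(i < r, j < r) (if i == j then A else 0))
         (\mxrow_(j < r) 1%:M).

(* The block submxcol u i is the i-th row of the r x n integer matrix
   identified with u. *)
Definition lawrence_type (r n : nat) (u : 'cV[int]_(\sum_(i < r) n)) : nat :=
  #|[set i : 'I_r | submxcol u i != 0]%SET|.

(* The integer c is the Markov complexity of A: the maximum of the types. *)
Definition markov_complexity_is (m n : nat) (A : 'M[nat]_(m, n)) (c : nat) :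
    Prop :=
  (exists r, (2 <= r)%N /\
     exists2 u : 'cV[int]_(\sum_(i < r) n),
       universal_markov (lawrence A r) u & lawrence_type u = c) /\
  (forall r, (2 <= r)%N -> forall u : 'cV[int]_(\sum_(i < r) n),
     universal_markov (lawrence A r) u -> (lawrence_type u <= c)%N).

Definition row3 (n1 n2 n3 : nat) : 'M[nat]_(1, 3) :=
  \row_(j < 3) nth 0%N [:: n1; n2; n3] j.

(* Main.v *)
Require Import Defs.
From mathcomp Require Import all_boot all_order all_algebra finmap.
From mathcomp Require Import boolp classical_sets cardinality.
From mathcomp Require Import mpoly.
From mathcomp Require Import zify ring.

Set Implicit Arguments.
Unset Strict Implicit.
Unset Printing Implicit Defensive.
Import Order.TTheory GRing.Theory Num.Theory.
Local Open Scope nat_scope.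

(** Let c_i be the least positive integer such that c_i n_i is a combination
    with coefficients rho_ij in N of the two other weights n_j.  If some rho_ij
    vanishes, then c_i n_i = c_j n_j for two indices i, j, and the toric ideal is
    generated by x_i^c_i - x_j^c_j and x_k^c_k - x^rho_k, hence is a complete
    intersection.  Otherwise (Herzog) the three vectors g_i = rho_i - c_i e_i are
    negative at position i and positive elsewhere, sum to zero and span the
    lattice: this is what [herzog_basis] records, together with the minimality of
    the c_i, and the rest of the proof uses nothing else but the positivity of the
    weights.

    An element of the lattice of the r-th Lawrence lifting is an r x 3 matrix
    with rows in the lattice and zero column sums.  The candidate universal
    Markov basis consists of the matrices with two nonzero rows h and -h, for h
    in the Graver basis, and of the matrices with three nonzero rows g_1, g_2, g_3
    in any order.  Two facts make it the only minimal Markov basis up to signs.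

    Every candidate is indispensable: the fiber of v^+ is reduced to v^+ and v^-.
    For two rows this is the primitivity of h.  For three rows, each row of the
    difference of two points of the fiber is 0 or g_a ([below_herzog]), and the
    only linear relation between the g_a is their sum.

    The candidates connect every fiber: for each nonzero lattice matrix u there
    is a candidate v with v^+ <= u^+ or v^- <= u^- such that u - v is shorter than
    u ([row_reduction]).  To see this, write row i of u as the sum of the t_ia g_a;
    the coefficients are unique up to an additive constant, and the sum V_i of
    the g_a with t_ia not minimal is +g_b or -g_b for some b and satisfies
    V_i^+ <= u_i^+ ([descent_argmin]).  Each nonzero row thus proposes the step
    V_i, which depends only on the set of indices a where t_ia is minimal.  Some
    two or three of the proposed steps sum to zero, and so form a candidate, as
    soon as these sets cover the three indices and have no common point
    ([family_ord3]); they have no common point, because the differences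
    t_ia - t_ib sum to zero over i.  Hence, if no candidate is found, some index c
    is minimal in no nonzero row; by the same argument applied to -u, some d is
    maximal in no nonzero row, and the zero sums force c = d.  Every nonzero row
    then has strictly opposite signs at the two other positions a, b, and both
    orders occur.  Two rows of opposite orders with opposite weak signs at
    position c lie, after negating one, in the same orthant, where one coordinate
    has a sign different from the two others; a Graver element conformal to the
    row whose coordinate there is the smaller in absolute value can be exchanged
    between the two rows ([opposed_exists]).

    The types are 2 and 3, and counting the candidates up to sign is counting
    pairs of rows times k, plus injections of three indices into r rows. *)

(** * Three indices *)

Lemma ord3_cases (i j k d : 'I_3) :
  i != j -> i != k -> j != k -> [\/ d = i, d = j | d = k].
Proof.
rewrite -!val_eqE /= => ij ik jk.
have [dE|[dE|dE]] : val d = val i \/ val d = val j \/ val d = val k.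
- by have := (ltn_ord i, ltn_ord j, ltn_ord k, ltn_ord d) => -[[[]]] /=; lia.
- by constructor 1; apply: val_inj.
- by constructor 2; apply: val_inj.
- by constructor 3; apply: val_inj.
Qed.

Lemma big_ord3 (T : Type) (idx : T) (op : Monoid.com_law idx)
    (F : 'I_3 -> T) (i j k : 'I_3) : i != j -> i != k -> j != k ->
  \big[op/idx]_d F d = op (F i) (op (F j) (F k)).
Proof.
move=> ij ik jk; rewrite (bigD1 i) //= (bigD1 j) /= 1?eq_sym // (bigD1 k) /=.
  rewrite big1 ?Monoid.mulm1 // => d /andP[/andP[di dj] dk].
  by have [] := ord3_cases d ij ik jk => dE; move: di dj dk; rewrite dE eqxx.
by rewrite eq_sym ik eq_sym jk.
Qed.

Lemma ord3_third (i j : 'I_3) : i != j -> exists2 k, i != k & j != k.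
Proof.
rewrite -val_eqE /= => ij; exists (inord (3 - (i + j))).
all: rewrite -val_eqE /= inordK; have := (ltn_ord i, ltn_ord j); case; lia.
Qed.

Lemma ord3_others (i : 'I_3) : exists j k, [/\ i != j, i != k & j != k].
Proof.
case: (eqVneq i 0%R) => [->|i0]; first by exists 1%R, (inord 2); rewrite -!val_eqE /= inordK.
by have [k ik ok] := ord3_third i0; exists 0%R, k.
Qed.

(** * Critical exponents of three weights *)

Section Critical.
Variable n : 'I_3 -> nat.
Hypothesis n_gt0 : forall i, 0 < n i.

(** The row rho i of exponents is one expression of n_i c_i by the other weights;
    it need not be unique. *)
Definition critical (c : 'I_3 -> nat) (rho : 'I_3 -> 'I_3 -> nat) : Prop :=
  [/\ forall i, 0 < c i, forall i, rho i i = 0,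
      forall i, \sum_j n j * rho i j = n i * c i
    & forall i a (y : 'I_3 -> nat), 0 < a -> y i = 0 ->
        \sum_j n j * y j = n i * a -> c i <= a].

Lemma critical_exists : exists c rho, critical c rho.
Proof.
pose P i a := 0 < a /\ exists y : 'I_3 -> nat, y i = 0 /\ \sum_j n j * y j = n i * a.
have exP i : exists a, `[< P i a >].
  have [j [k [ij ik jk]]] := ord3_others i.
  (* n_i n_j is a multiple of n_j *)
  exists (n j); apply/asboolP; split=> //.
  exists (fun d => if d == j then n i else 0); split; first by rewrite (negPf ij).
  rewrite (big_ord3 _ _ ij ik jk) /= (negPf ij) eqxx eq_sym (negPf jk); lia.
have min i : exists2 a, P i a & forall b, P i b -> a <= b.
  case: (ex_minnP (exP i)) => a /asboolP Pa am; exists a => // b Pb.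
  by apply: am; apply/asboolP.
have /choice[c cP] i : exists a, P i a /\ forall b, P i b -> a <= b.
  by have [a Pa am] := min i; exists a.
have /choice[rho rhoP] i := (cP i).1.2.
exists c, rho; split=> [i|i|i|i a y a0 yi ya]; first exact: (cP i).1.1.
- by have [] := rhoP i.
- by have [] := rhoP i.
- by apply: (cP i).2; split=> //; exists y.
Qed.

Variables (c : 'I_3 -> nat) (rho : 'I_3 -> 'I_3 -> nat).
Hypothesis crit : critical c rho.

Lemma critical_rel i j k : i != j -> i != k -> j != k ->
  n j * rho i j + n k * rho i k = n i * c i.
Proof.
case: crit => _ rho0 rhoE _ ij ik jk.
by rewrite -rhoE (big_ord3 _ _ ij ik jk) /= rho0 muln0.
Qed.

Lemma critical_min i j k a b e : i != j -> i != k -> j != k ->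
  0 < a -> n j * b + n k * e = n i * a -> c i <= a.
Proof.
case: crit => _ _ _ cmin ij ik jk a0 aE.
apply: (cmin i a (fun d => if d == j then b else if d == k then e else 0)) => //.
  by rewrite (negPf ij) (negPf ik).
rewrite (big_ord3 _ _ ij ik jk) /= (negPf ij) (negPf ik) !eqxx eq_sym (negPf jk).
by rewrite muln0.
Qed.

(** The monomial x_i^c_i is alone in its fiber among those involving x_i: dividing
    another one by its power of x_i would contradict the minimality of c_i. *)
Lemma critical_fiber i j k x y z : i != j -> i != k -> j != k ->
  n i * x + n j * y + n k * z = n i * c i -> 0 < x -> y = 0 /\ z = 0.
Proof.
move=> ij ik jk xE x0; have [nj nk] := (n_gt0 j, n_gt0 k).
have [xc|cx] := ltnP x (c i); last by nia.
have : c i <= c i - x.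
  by apply: (critical_min (b := y) (e := z) ij ik jk); rewrite ?mulnBr -?xE; lia.
lia.
Qed.

(** If rho i j = 0, then n_i c_i is a multiple r n_k.  Substitute the expressions
    of n_k c_k, then of n_j c_j, into r n_k (unless r = c_k): by [critical_fiber] the index i never
    appears, so n_j c_j and n_k c_k are multiples of n_k and n_j respectively,
    and minimality makes them equal. *)
Lemma critical_dichotomy :
  (exists i j, i != j /\ n i * c i = n j * c j) \/
  (forall i j, i != j -> 0 < rho i j).
Proof.
have [?|noeq] := pselect (exists i j : 'I_3, i != j /\ n i * c i = n j * c j); first by left.
right=> i j ij.
rewrite lt0n; apply/negP => /eqP r0; apply: noeq.
have [k ik jk] := ord3_third ij.
have [ji ki kj] : [/\ j != i, k != i & k != j] by rewrite !(eq_sym k) eq_sym.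
have c0 : forall d, 0 < c d by case: crit.
have relI := critical_rel ij ik jk.
have relJ := critical_rel ji jk ik.
have relK := critical_rel ki kj ij.
have [[ci cj] ck] := (c0 i, c0 j, c0 k).
have [[ni nj] nk] := (n_gt0 i, n_gt0 j, n_gt0 k).
rewrite r0 muln0 add0n in relI.
have ckr : c k <= rho i k.
  apply: (critical_min ki kj ij (b := c i) (e := 0)); last by lia.
  by case: (rho i k) relI => // ; nia.
have [ckE|ckN] := eqVneq (c k) (rho i k); first by exists i, k; rewrite ckE.
have rki : rho k i = 0.
  have [->//|r1] := posnP (rho k i).
  have [||_] := @critical_fiber i j k (rho k i) (rho k j) (rho i k - c k) ij ik jk => //; last by lia.
  rewrite mulnBr -relI; nia.
rewrite rki muln0 add0n in relK.
have cjr : c j <= rho k j.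
  apply: (critical_min ji jk ik (b := 0) (e := c k)); last by lia.
  by case: (rho k j) relK => //; nia.
have rji : rho j i = 0.
  have [->//|r1] := posnP (rho j i).
  have [||_] := @critical_fiber i j k (rho j i) (rho k j - c j)
    (rho i k - c k + rho j k) ij ik jk => //; last by lia.
  rewrite mulnDr !mulnBr -relI -relK; nia.
rewrite rji muln0 add0n in relJ.
exists j, k; split=> //.
have ckr' : c k <= rho j k.
  apply: (critical_min ki kj ij (b := 0) (e := c j)); last by lia.
  by case: (rho j k) relJ => //; nia.
by nia.
Qed.

Hypothesis rho_gt0 : forall i j, i != j -> 0 < rho i j.

Lemma critical_lt i j : i != j -> rho j i < c i.
Proof.
move=> ij; have [k ik jk] := ord3_third ij.
have [ji ki kj] : [/\ j != i, k != i & k != j] by rewrite !(eq_sym k) eq_sym.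
rewrite ltnNge; apply/negP => cr.
have relI := critical_rel ij ik jk.
have relJ := critical_rel ji jk ik.
have := rho_gt0 ij; have := rho_gt0 ik; move=> rik rij.
have [||_] := @critical_fiber j i k (rho i j) (rho j i - c i)
  (rho i k + rho j k) ji jk ik => //; last by lia.
rewrite mulnDr !mulnBr -relJ; nia.
Qed.

(** No column sum of rho is less than c_j: [critical_lt] turns the relations of
    the two other indices into an expression of a multiple of n_j.  Weighted by
    the n_j, the column sums and the c_j have the same total. *)
Lemma critical_sum j : \sum_i rho i j = c j.
Proof.
have rho0 : forall i, rho i i = 0 by case: crit.
have le i : c i <= \sum_d rho d i.
  have [j' [k [ij ik jk]]] := ord3_others i.
  have [ji ki kj] : [/\ j' != i, k != i & k != j'] by rewrite !(eq_sym k) eq_sym.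
  have relJ := critical_rel ji jk ik.
  have relK := critical_rel ki kj ij.
  rewrite (big_ord3 _ _ ij ik jk) /= rho0 add0n.
  have ltj := critical_lt jk; have ltk := critical_lt kj.
  apply: (critical_min ij ik jk (b := c j' - rho k j') (e := c k - rho j' k)).
    by have := rho_gt0 ji; lia.
  rewrite !mulnBr mulnDr; nia.
have eqW : \sum_i n i * (\sum_d rho d i) = \sum_i n i * c i.
  have [_ _ rhoE _] := crit.
  under eq_bigr do rewrite big_distrr /=.
  by rewrite exchange_big /=; apply: eq_bigr => i _; rewrite rhoE.
apply/eqP; rewrite eqn_leq le andbT.
have : \sum_i n i * (\sum_d rho d i) <= \sum_i n i * c i by rewrite eqW.
rewrite (bigD1 j) //= [X in _ <= X](bigD1 j) //= => H.
rewrite -(leq_pmul2l (n_gt0 j)) -(leq_add2r (\sum_(i | i != j) n i * (\sum_d rho d i))).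
apply: leq_trans H _; rewrite leq_add2l.
by apply: leq_sum => i _; rewrite leq_mul2l le orbT.
Qed.

End Critical.

(** * Congruences on monomials *)

Section Congruence.
Variable n : 'I_3 -> nat.
Hypothesis n_gt0 : forall i, 0 < n i.

Definition wdeg (x : 'X_{1..3}) : nat := \sum_i n i * x i.

Lemma wdegD x y : wdeg (x + y)%MM = wdeg x + wdeg y.
Proof.
by rewrite /wdeg -big_split /=; apply: eq_bigr => i _; rewrite mnmDE mulnDr.
Qed.

Lemma wdegU i a : wdeg (U_(i) *+ a)%MM = n i * a.
Proof.
rewrite /wdeg (bigD1 i) //= big1 => [|j ji]; rewrite mulmnE mnm1E.
  by rewrite eqxx mul1n addn0.
by rewrite eq_sym (negPf ji) mul0n muln0.
Qed.

Lemma wdeg_eq0 x : wdeg x = 0 -> x = 0%MM.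
Proof.
move=> /eqP; rewrite sum_nat_eq0 => /forallP x0; apply/mnmP => i; rewrite mnm0E.
by have := x0 i; rewrite /= muln_eq0 => /orP[/eqP ni|/eqP//]; have := n_gt0 i; rewrite ni.
Qed.

(** Congruences finer than the degree.  The notion covers both the membership of
    x^u - x^w in an ideal and that of u - w in a subgroup of the lattice. *)
Definition graded_congruence (E : 'X_{1..3} -> 'X_{1..3} -> Prop) : Prop :=
  [/\ forall x, E x x, forall x y, E x y -> E y x,
      forall x y z, E x y -> E y z -> E x z,
      forall x y z, E x y -> E (x + z)%MM (y + z)%MM
    & forall x y, E x y -> wdeg x = wdeg y].

Variable E : 'X_{1..3} -> 'X_{1..3} -> Prop.
Hypothesis EP : graded_congruence E.

Definition reaches x i := exists2 x', E x x' & 0 < x' i.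

Lemma reaches_refl (x : 'X_{1..3}) i : 0 < x i -> reaches x i.
Proof. by case: EP => Er _ _ _ _ xi; exists x. Qed.

Lemma reaches_step (x z : 'X_{1..3}) d a i :
  E (U_(d) *+ a)%MM z -> a <= x d -> 0 < z i -> reaches x i.
Proof.
case: EP => _ _ _ Ea _ Edz axd zi.
have xE : x = (U_(d) *+ a + (x - U_(d) *+ a))%MM.
  apply/mnmP => e; rewrite mnmDE mnmBE mulmnE mnm1E.
  by case: eqP => [<-|_]; lia.
exists (z + (x - U_(d) *+ a))%MM; first by rewrite {1}xE; exact: Ea.
by rewrite mnmDE; lia.
Qed.

(** Once two monomials of the same degree are equivalent to monomials with a
    common variable, that variable cancels and the degree drops. *)
Lemma congruence_fiber :
  (forall x y, wdeg x = wdeg y -> x <> 0%MM -> y <> 0%MM ->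
     exists i, reaches x i /\ reaches y i) ->
  forall x y, wdeg x = wdeg y -> E x y.
Proof.
case: EP => Er Es Et Ea Ed link x y.
have [N] := ubnP (wdeg x); elim: N x y => // N IH x y xN xy.
have [x0|/eqP x0] := eqVneq x 0%MM.
  have y0 : wdeg y = 0 by rewrite -xy x0 /wdeg big1 // => i _; rewrite mnm0E muln0.
  by rewrite x0 (wdeg_eq0 y0).
have y0 : y <> 0%MM.
  move=> y0; apply: x0; apply: wdeg_eq0; rewrite xy y0 /wdeg.
  by rewrite big1 // => i _; rewrite mnm0E muln0.
have [i [[x' xx' x'i] [y' yy' y'i]]] := link _ _ xy x0 y0.
have split (z : 'X_{1..3}) : 0 < z i -> z = ((z - U_(i) *+ 1) + U_(i) *+ 1)%MM.
  by move=> zi; apply/mnmP => e; rewrite mnmDE mnmBE mulmnE mnm1E; case: eqP => [<-|]; lia.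
have dx := Ed _ _ xx'; have dy := Ed _ _ yy'.
apply: (Et _ _ _ xx' _); apply: (Et _ _ _ _ (Es _ _ yy')).
rewrite (split _ x'i) (split _ y'i); apply: Ea; have := n_gt0 i.
move: dx dy; rewrite {1}(split _ x'i) {1}(split _ y'i) !wdegD wdegU => dx dy ni.
by apply: IH; lia.
Qed.

Variables (c : 'I_3 -> nat) (rho : 'I_3 -> 'I_3 -> nat).
Hypothesis crit : critical n c rho.

Lemma fiber_pure_power (x y : 'X_{1..3}) i j k : i != j -> i != k -> j != k ->
  wdeg x = wdeg y -> 0 < x i -> x j = 0 -> x k = 0 -> y i = 0 -> c i <= x i.
Proof.
move=> ij ik jk xy xi xj xk yi; apply: (critical_min crit (b := y j) (e := y k) ij ik jk) => //.
by move: xy; rewrite /wdeg !(big_ord3 _ _ ij ik jk) /= xj xk yi; lia.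
Qed.

(** In three variables, two monomials of the same fiber with disjoint supports
    cannot both involve two variables: one of them is a pure power. *)
Lemma fiber_pure_powerP (x y : 'X_{1..3}) : wdeg x = wdeg y -> x <> 0%MM -> y <> 0%MM ->
  (forall i, 0 < x i -> y i = 0) ->
  exists i j k, [/\ i != j, i != k, j != k &
    [/\ x j = 0, x k = 0, y i = 0, c i <= x i & 0 < y j] \/
    [/\ y j = 0, y k = 0, x i = 0, c i <= y i & 0 < x j]].
Proof.
move=> xy x0 y0 dis.
have supp z : z <> 0%MM -> exists i : 'I_3, 0 < z i.
  move=> z0; apply: contrapT => nz; apply: z0; apply/mnmP => i; rewrite mnm0E.
  by apply/eqP; rewrite -leqn0 leqNgt; apply/negP => zi; apply: nz; exists i.
have [i xi] := supp _ x0; have [j yj] := supp _ y0.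
have ij : i != j by apply/eqP => ijE; move: (dis i xi); rewrite ijE; lia.
have [k ik jk] := ord3_third ij.
have [ji kj ki] : [/\ j != i, k != j & k != i] by rewrite !(eq_sym k) eq_sym.
have yi := dis i xi.
have xj : x j = 0 by case: (posnP (x j)) => // /dis; lia.
case: (posnP (x k)) => [xk|xk].
  by exists i, j, k; split=> //; left; split=> //; exact: (fiber_pure_power ij ik jk xy).
have yk := dis k xk.
by exists j, i, k; split=> //; right; split=> //; exact: (fiber_pure_power ji jk ik (esym xy)).
Qed.

(** One step on a pure power of exponent at least c_i produces all the other
    variables when every rho i j is positive. *)
Lemma congruence_positive_relations :
  (forall i j, i != j -> 0 < rho i j) ->
  (forall i, E (U_(i) *+ c i)%MM [multinom rho i j | j < 3]) ->
  forall x y, wdeg x = wdeg y -> E x y.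
Proof.
move=> rho0 Egen; apply: congruence_fiber => x y xy x0 y0.
have [[i [xi yi]]|dis] := pselect (exists i : 'I_3, 0 < x i /\ 0 < y i).
  by exists i; split; exact: reaches_refl.
have {}dis i : 0 < x i -> y i = 0.
  by move=> xi; case: (posnP (y i)) => // yi; case: dis; exists i.
have [i [j [k [ij ik jk [[_ _ _ ci ej]|[_ _ _ ci ej]]]]]] := fiber_pure_powerP xy x0 y0 dis.
all: exists j; split; (try exact: reaches_refl); apply: (reaches_step (Egen i) ci).
all: by rewrite mnmE rho0.
Qed.

(** The case of [congruence_fiber] in which x is a pure power and y does not
    involve its variable. *)
Lemma complete_intersection_link i j k (x y : 'X_{1..3}) : i != j -> i != k -> j != k ->
  n i * c i = n j * c j -> E (U_(i) *+ c i)%MM (U_(j) *+ c j)%MM ->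
  E (U_(k) *+ c k)%MM [multinom rho k d | d < 3] ->
  wdeg x = wdeg y -> y <> 0%MM ->
  (exists d, [/\ c d <= x d, y d = 0 & forall e, e != d -> x e = 0]) ->
  exists d, reaches x d /\ reaches y d.
Proof.
move=> ij ik jk cij Eij Ek xy y0.
have [ji kj ki] : [/\ j != i, k != j & k != i] by rewrite !(eq_sym k) eq_sym.
case: (EP) => _ Es _ _ _; have Eji := Es _ _ Eij.
have [cp _ _ _] := crit.
have Ui d : 0 < (U_(d) *+ c d)%MM d by rewrite mulmnE mnm1E eqxx mul1n.
have relK := critical_rel crit ki kj ij.
have rk : 0 < rho k i \/ 0 < rho k j by have := cp k; have := n_gt0 k; nia.
have mk d : [multinom rho k e | e < 3]%MM d = rho k d by rewrite mnmE.
case=> d [cd yd xd].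
(* if y does not involve a, it is a pure power of b *)
have suppy a b : d != a -> d != b -> a != b -> 0 < y a \/ y a = 0 /\ c b <= y b.
  move=> da db ab; case: (posnP (y a)) => ya; [right|by left]; split=> //.
  have [yb|yb] := posnP (y b).
    case: y0; apply/mnmP => e; rewrite mnm0E.
    by have [->|->|->] := ord3_cases e da db ab.
  have [ba bd ad] : [/\ b != a, b != d & a != d] by rewrite eq_sym ab eq_sym db eq_sym.
  by apply: (fiber_pure_power ba bd ad (esym xy)) => //; apply: xd; rewrite eq_sym.
have [dE|dE|dE] := ord3_cases d ij ik jk; subst d.
- have [yj|[yj ck]] := suppy j k ij ik jk.
    by exists j; split; [exact: (reaches_step Eij cd)|exact: reaches_refl].
  case: rk => r; [exists i|exists j]; split; try by apply: (reaches_step Ek ck); rewrite mk.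
    by apply: reaches_refl; apply: leq_trans cd.
  exact: (reaches_step Eij cd).
- have [yi|[yi ck]] := suppy i k ji jk ik.
    by exists i; split; [exact: (reaches_step Eji cd)|exact: reaches_refl].
  case: rk => r; [exists i|exists j]; split; try by apply: (reaches_step Ek ck); rewrite mk.
    exact: (reaches_step Eji cd).
  by apply: reaches_refl; apply: leq_trans cd.
- case: rk => r; [exists i|exists j]; split; try by apply: (reaches_step Ek cd); rewrite mk.
    have [yi|[yi cj]] := suppy i j ki kj ij; first exact: reaches_refl.
    exact: (reaches_step Eji cj).
  have [yj|[yj cj]] := suppy j i kj ki ji; first exact: reaches_refl.
  exact: (reaches_step Eij cj).
Qed.

Lemma congruence_complete_intersection i j k : i != j -> i != k -> j != k ->
  n i * c i = n j * c j -> E (U_(i) *+ c i)%MM (U_(j) *+ c j)%MM ->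
  E (U_(k) *+ c k)%MM [multinom rho k d | d < 3] ->
  forall x y, wdeg x = wdeg y -> E x y.
Proof.
move=> ij ik jk cij Eij Ek; apply: congruence_fiber => x y xy x0 y0.
have [[d [xd yd]]|dis] := pselect (exists i : 'I_3, 0 < x i /\ 0 < y i).
  by exists d; split; exact: reaches_refl.
have {}dis d : 0 < x d -> y d = 0.
  by move=> xd; case: (posnP (y d)) => // yd; case: dis; exists d.
have [d [e [f [de df ef [[xe xf yd cd _]|[ye yf xd cd _]]]]]] := fiber_pure_powerP xy x0 y0 dis.
  apply: (complete_intersection_link ij ik jk) => //; exists d; split=> // g gd.
  by have [E'|->|->] := ord3_cases g de df ef; first by rewrite E' eqxx in gd.
suff [g [yg xg]] : exists d, reaches y d /\ reaches x d by exists g.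
apply: (complete_intersection_link ij ik jk) => //; exists d; split=> // g gd.
by have [E'|->|->] := ord3_cases g de df ef; first by rewrite E' eqxx in gd.
Qed.

End Congruence.

(** * Toric ideals and complete intersections *)

Local Open Scope ring_scope.

Lemma lattice1E m (A : 'M[nat]_(1, m)) (u : 'cV[int]_m) :
  lattice A u <-> \sum_j (A ord0 j)%:Z * u j 0 = 0.
Proof.
rewrite /lattice /=; split=> [/matrixP/(_ 0 0)|Au].
  by rewrite !mxE => Au; rewrite -[RHS]Au; apply: eq_bigr => k _; rewrite !mxE.
apply/matrixP => i j; rewrite !ord1 !mxE -[RHS]Au.
by apply: eq_bigr => k _; rewrite mxE.
Qed.

Section IdealGenerated.
Local Open Scope classical_set_scope.
Variable R : comNzRingType.
Implicit Types (G H : set R) (f g : R).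

Lemma ideal_gen0 G : ideal_generated G 0.
Proof. by exists [::]; split=> //; rewrite big_nil. Qed.

Lemma ideal_gen_mem G f : G f -> ideal_generated G f.
Proof.
move=> Gf; exists [:: (1, f)]; split=> [ag|]; last by rewrite big_seq1 mul1r.
by rewrite inE => /eqP->.
Qed.

Lemma ideal_genD G f g :
  ideal_generated G f -> ideal_generated G g -> ideal_generated G (f + g).
Proof.
move=> [s [sG ->]] [t [tG ->]]; exists (s ++ t); split; last by rewrite big_cat.
by move=> ag; rewrite mem_cat => /orP[/sG|/tG].
Qed.

Lemma ideal_genM G f g : ideal_generated G f -> ideal_generated G (g * f).
Proof.
move=> [s [sG ->]]; exists [seq (g * ag.1, ag.2) | ag <- s]; split.
  by move=> _ /mapP[ag /sG Gag ->].
by rewrite big_map big_distrr /=; apply: eq_bigr => ag _; rewrite mulrA.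
Qed.

Lemma ideal_genN G f : ideal_generated G f -> ideal_generated G (- f).
Proof. by move=> If; rewrite -mulN1r; exact: ideal_genM. Qed.

Lemma ideal_gen_sub G H :
  G `<=` ideal_generated H -> ideal_generated G `<=` ideal_generated H.
Proof.
move=> GH _ [s [sG ->]]; rewrite big_seq; elim/big_ind : _ => [|f g|ag /sG Gag].
- exact: ideal_gen0.
- exact: ideal_genD.
- by apply/ideal_genM/GH.
Qed.

End IdealGenerated.

Lemma absz_pos_neg (z : int) :
  `|Num.max z 0|%N%:Z - `|Num.max (- z) 0|%N%:Z = z.
Proof. lia. Qed.

Section CompleteIntersection.
Variables (K : fieldType) (A : 'M[nat]_(1, 3)).
Hypothesis A_gt0 : forall j, (0 < A ord0 j)%N.

Lemma lattice_fiber (x y : 'X_{1..3}) :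
  lattice A (\col_i ((x i)%:Z - (y i)%:Z)) <-> wdeg (A ord0) x = wdeg (A ord0) y.
Proof.
rewrite lattice1E; under eq_bigr do rewrite mxE mulrBr -!PoszM.
rewrite sumrB -!(big_morph Posz PoszD (erefl _)) /wdeg.
by split=> [/eqP|->]; [rewrite subr_eq0 => /eqP[]|rewrite subrr].
Qed.

Lemma ideal_congruence (G : set {mpoly K[3]}) :
  graded_congruence (A ord0) (fun x y => wdeg (A ord0) x = wdeg (A ord0) y /\
    ideal_generated G ('X_[x] - 'X_[y])).
Proof.
split=> [x|x y [-> xy]|x y z [-> xy] [-> yz]|x y z [xyd xy]|x y []] //.
- by rewrite subrr; split=> //; exact: ideal_gen0.
- by rewrite -opprB; split=> //; exact: ideal_genN.
- by split=> //; rewrite -(subrKA 'X_[y]); exact: ideal_genD.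
- by rewrite !wdegD xyd !mpolyXD -mulrBl mulrC; split=> //; exact: ideal_genM.
Qed.

Lemma toric_complete_intersection c rho (i j : 'I_3) : critical (A ord0) c rho ->
  i != j -> (A ord0 i * c i = A ord0 j * c j)%N -> complete_intersection3 K A.
Proof.
move=> crit ij cij; have [k ik jk] := ord3_third ij.
pose r := [multinom rho k d | d < 3].
pose f : {mpoly K[3]} := 'X_[U_(i) *+ c i] - 'X_[U_(j) *+ c j].
pose g : {mpoly K[3]} := 'X_[U_(k) *+ c k] - 'X_[r].
have degr : wdeg (A ord0) (U_(k) *+ c k)%MM = wdeg (A ord0) r.
  rewrite wdegU; case: crit => _ _ rhoE _; rewrite -rhoE.
  by apply: eq_bigr => d _; rewrite mnmE.
exists f, g; apply/seteqP; split; apply: ideal_gen_sub.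
  move=> _ [x [y [/lattice_fiber xy ->]]].
  have /= Econg := ideal_congruence [set f; g].
  have [||] := congruence_complete_intersection A_gt0 Econg crit ij ik jk cij _ _ xy => //.
    by split; [rewrite !wdegU|apply: ideal_gen_mem; left].
  by split=> //; apply: ideal_gen_mem; right.
move=> _ [->|->]; apply: ideal_gen_mem.
  exists (U_(i) *+ c i)%MM, (U_(j) *+ c j)%MM; split=> //.
  by apply/lattice_fiber; rewrite !wdegU.
by exists (U_(k) *+ c k)%MM, r; split=> //; apply/lattice_fiber.
Qed.

End CompleteIntersection.

(** * Herzog bases *)

(** The last field is the minimality of c_a = - g_aa: it speaks of lattice vectors
    whose only positive entry is at a. *)
Record herzog_basis (A : 'M[nat]_(1, 3)) (g : 'I_3 -> 'cV[int]_3) : Prop := {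
  herzog_lattice : forall a, lattice A (g a);
  herzog_pos : forall a b, a != b -> 0 < g a b 0;
  herzog_sum : \sum_a g a = 0;
  herzog_span : forall u, lattice A u ->
    exists t : 'I_3 -> int, u = \sum_a t a *: g a;
  herzog_min : forall a (z : 'cV[int]_3), lattice A z -> 0 < z a 0 ->
    (forall b, b != a -> z b 0 <= 0) -> - g a a 0 <= z a 0 }.

Lemma herzog_basis_exists (K : fieldType) (A : 'M[nat]_(1, 3)) :
  (forall j, (0 < A ord0 j)%N) -> ~ complete_intersection3 K A ->
  exists g, herzog_basis A g.
Proof.
move=> A_gt0 nci; have [c [rho crit]] := critical_exists A_gt0.
have [[i [j [ij cij]]]|rho_gt0] := critical_dichotomy A_gt0 crit.
  by case: nci; exact: (toric_complete_intersection K A_gt0 crit ij cij).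
have [c_gt0 rho0 rhoE cmin] := crit.
have csum := critical_sum A_gt0 crit rho_gt0.
pose g a : 'cV[int]_3 := \col_b ((rho a b)%:Z - ((a == b) * c a)%N%:Z).
have gneq a b : a != b -> g a b 0 = (rho a b)%:Z.
  by move=> ab; rewrite mxE (negPf ab) mul0n subr0.
have geq a : g a a 0 = - (c a)%:Z by rewrite mxE rho0 eqxx mul1n sub0r.
have glat a : lattice A (g a).
  apply/lattice1E; under eq_bigr do rewrite mxE mulrBr -!PoszM.
  rewrite sumrB -!(big_morph Posz PoszD (erefl _)) rhoE (bigD1 a) //= eqxx mul1n.
  rewrite big1 ?addn0 ?subrr // => b ba.
  by rewrite eq_sym (negPf ba) mul0n muln0.
exists g; split=> //.
- by move=> a b ab; rewrite gneq // ltz_nat rho_gt0.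
- apply/matrixP => b j; rewrite ord1 summxE mxE.
  under eq_bigr do rewrite mxE.
  rewrite sumrB -!(big_morph Posz PoszD (erefl _)) csum (bigD1 b) //= eqxx mul1n.
  by rewrite big1 ?addn0 ?subrr // => a /negPf->.
(* the congruence modulo the subgroup spanned by the g_a is the whole fiber relation *)
- pose E (x y : 'X_{1..3}) := wdeg (A ord0) x = wdeg (A ord0) y /\
    exists t : 'I_3 -> int, \col_i ((x i)%:Z - (y i)%:Z) = \sum_a t a *: g a.
  have Econg : graded_congruence (A ord0) E.
    rewrite /E; split=> [x|x y [-> [t tE]]|x y z [-> [t tE]] [-> [s sE]]|x y z [xy [t tE]]|x y []] //.
    + split=> //; exists (fun=> 0); rewrite big1 => [|a _]; last by rewrite scale0r.
      by apply/matrixP => a b; rewrite !mxE subrr.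
    + split=> //; exists (fun a => - t a); under eq_bigr do rewrite scaleNr.
      rewrite sumrN -tE; apply/matrixP => a b; rewrite !mxE; ring.
    + split=> //; exists (fun a => t a + s a); under eq_bigr do rewrite scalerDl.
      rewrite big_split -tE -sE; apply/matrixP => a b; rewrite !mxE; ring.
    + rewrite !wdegD xy; split=> //; exists t; rewrite -tE.
      by apply/matrixP => a b; rewrite !mxE !mnmDE !PoszD; ring.
  have Eall := congruence_positive_relations A_gt0 Econg crit rho_gt0.
  move=> u Au.
  pose x := [multinom `|(Num.max (u i 0) 0)%R|%N | i < 3].
  pose y := [multinom `|(Num.max (- u i 0) 0)%R|%N | i < 3].
  have uE : \col_i ((x i)%:Z - (y i)%:Z) = u.
    by apply/matrixP => a b; rewrite ord1 mxE !mnmE absz_pos_neg.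
  have Egen i : E (U_(i) *+ c i)%MM [multinom rho i j | j < 3].
    split; first by rewrite wdegU -rhoE; apply: eq_bigr => d _; rewrite mnmE.
    exists (fun a => - (a == i)%:R); rewrite (bigD1 i) //= big1 => [|a /negPf ai].
      rewrite eqxx scaleN1r addr0; apply/matrixP => a b.
      by rewrite !mxE mulmnE mnm1E !mnmE opprB.
    by rewrite ai oppr0 scale0r.
  have [|_ [t tE]] := Eall Egen x y; first by apply/lattice_fiber; rewrite uE.
  by exists t; rewrite -uE.
- move=> a z /lattice1E Az za zb; rewrite geq opprK.
  have [//|ca] := lerP (c a)%:Z (z a 0).
  have [j [k [aj ak jk]]] := ord3_others a.
  have zj : z j 0 <= 0 by apply: zb; rewrite eq_sym.
  have zk : z k 0 <= 0 by apply: zb; rewrite eq_sym.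
  rewrite (big_ord3 _ _ aj ak jk) /= in Az.
  suff : (c a <= `|(z a 0)%R|)%N by lia.
  apply: (critical_min (b := `|(z j 0)%R|%N) (e := `|(z k 0)%R|%N) crit aj ak jk); first by lia.
  apply/eqP; rewrite -eqz_nat PoszD !PoszM (gtz0_abs za) (lez0_abs zj) (lez0_abs zk); apply/eqP.
  move: Az; move: (z a 0) (z j 0) (z k 0) => x y w; lia.
Qed.

(** * Markov bases and distance reduction *)

Lemma nonnegP N (u : 'cV[int]_N) : nonneg u <-> forall p, 0 <= u p 0.
Proof.
split=> [/mxOverP u0 p|u0]; first exact: u0.
by apply/mxOverP => p j; rewrite ord1 nnegrE.
Qed.

Section Lattice.
Variables (m N : nat) (D : 'M[nat]_(m, N)).
Implicit Types u v : 'cV[int]_N.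

Lemma lattice0 : lattice D 0.
Proof. exact: mulmx0. Qed.

Lemma latticeD u v : lattice D u -> lattice D v -> lattice D (u + v).
Proof. by rewrite /lattice /= mulmxDr => -> ->; rewrite addr0. Qed.

Lemma latticeN u : lattice D u -> lattice D (- u).
Proof. by rewrite /lattice /= mulmxN => ->; rewrite oppr0. Qed.

Lemma latticeB u v : lattice D u -> lattice D v -> lattice D (u - v).
Proof. by move=> Du /latticeN; exact: latticeD. Qed.

Lemma lattice_sum (I : Type) (s : seq I) (P : pred I) (F : I -> 'cV[int]_N) :
  (forall i, P i -> lattice D (F i)) -> lattice D (\sum_(i <- s | P i) F i).
Proof. by move=> DF; elim/big_ind: _ => //; [exact: lattice0|exact: latticeD]. Qed.

End Lattice.

Section Markov.
Local Open Scope classical_set_scope.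
Variables (m N : nat) (D : 'M[nat]_(m, N)).
Implicit Types (u v w x : 'cV[int]_N) (M R : {fset 'cV[int]_N}).

Definition signed_mem M v := v \in M \/ - v \in M.

Lemma signed_memN M v : signed_mem M v -> signed_mem M (- v).
Proof. by case=> [vM|]; [right; rewrite opprK|left]. Qed.

Definition walk M w u := exists s : seq 'cV[int]_N,
  [/\ forall v, v \in s -> signed_mem M v, w - u = \sum_(v <- s) v
    & forall p, (1 <= p <= size s)%N -> nonneg (w - \sum_(v <- take p s) v)].

Lemma walk_refl M w : walk M w w.
Proof. by exists [::]; split=> [//||[]//]; rewrite big_nil subrr. Qed.

Lemma walk_trans M w x u : walk M w x -> walk M x u -> walk M w u.
Proof.
move=> [s [sM sE sp]] [t [tM tE tp]]; exists (s ++ t); split.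
- by move=> v; rewrite mem_cat => /orP[/sM|/tM].
- by rewrite big_cat -sE -tE /= subrKA.
move=> p /andP[p1]; rewrite size_cat => pst; rewrite take_cat.
case: ltnP => ps; first by apply: sp; rewrite p1 ltnW.
rewrite big_cat /= opprD addrA -sE subKr.
have [q0|q0] := posnP (p - size s); last by apply: tp; rewrite q0 leq_subLR.
rewrite q0 take0 big_nil subr0.
have := sp (size s); rewrite take_size -sE subKr leqnn andbT; apply; lia.
Qed.

Lemma walk_step M w x : signed_mem M (w - x) -> nonneg x -> walk M w x.
Proof.
move=> wx x0; exists [:: w - x]; split=> [v||[|[|]] //= _]; rewrite ?big_seq1 //.
  by rewrite inE => /eqP->.
by rewrite subKr.
Qed.

Definition l1 u : nat := \sum_p `|u p 0%R|%N.

(** This is v^+ <= u^+: from any w, w' >= 0 with w - w' = u, the move from w to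
    w - v stays in the positive orthant. *)
Definition below v u : Prop := forall p, 0 < v p 0 -> v p 0 <= u p 0.

Lemma l1N u : l1 (- u) = l1 u.
Proof. by apply: eq_bigr => p _; rewrite mxE abszN. Qed.

(** Subtracting v decreases the norm by at least the sum of the entries of v,
    which is zero, and by more wherever u and v are both negative. *)
Lemma l1_below v u : below v u -> \sum_p v p 0 = 0 ->
  (exists p, v p 0 < 0 /\ u p 0 < 0) -> (l1 (u - v) < l1 u)%N.
Proof.
move=> vu v0 [p [vp up]].
suff : (l1 (u - v))%:Z < \sum_p (`|u p 0%R|%N%:Z - v p 0).
  by rewrite sumrB v0 subr0 -(big_morph Posz PoszD (erefl _)) ltz_nat.
rewrite /l1 (big_morph Posz PoszD (erefl _)).
have le q : `|(u - v)%R q 0%R|%N%:Z <= `|u q 0%R|%N%:Z - v q 0.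
  rewrite !mxE; have := vu q; move: (u q 0) (v q 0) => x y; lia.
rewrite (bigD1 p) // [ltRHS](bigD1 p) //=; apply: ltr_leD; last exact: ler_sum.
by rewrite !mxE; move: (u p 0) (v p 0) up vp => x y; lia.
Qed.

(** The move v is made at the start of the walk when v^+ <= u^+, and at its end
    when v^- <= u^-. *)
Lemma markov_of_reduction M : [set` M] `<=` lattice D ->
  (forall u, lattice D u -> u <> 0 -> exists v, [/\ signed_mem M v,
     below v u \/ below (- v) (- u) & (l1 (u - v) < l1 u)%N]) ->
  markov_basis D M.
Proof.
move=> MD red; split=> // w u; have [k] := ubnP (l1 (w - u)).
elim: k w u => // k IH w u wuk w0 u0 Dwu.
have [->|/eqP wu] := eqVneq w u; first exact: walk_refl.
have [|v [Mv vbelow vlt]] := red _ Dwu; first by move/subr0_eq.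
have Dv : lattice D v.
  case: Mv => [/MD//|vM]; rewrite -[v]opprK; apply: latticeN; exact: MD.
case: vbelow => vwu.
  have wv0 : nonneg (w - v).
    apply/nonnegP => p; move/nonnegP/(_ p): w0; move/nonnegP/(_ p): u0.
    by have := vwu p; rewrite !mxE; move: (w p 0) (u p 0) (v p 0) => x y z; lia.
  apply: (@walk_trans _ _ (w - v)); first by apply: walk_step; rewrite ?subKr.
  apply: IH; rewrite // addrAC; last exact: latticeB.
  by apply: leq_trans vlt _.
have uv0 : nonneg (u + v).
  apply/nonnegP => p; move/nonnegP/(_ p): w0; move/nonnegP/(_ p): u0.
  by have := vwu p; rewrite !mxE; move: (w p 0) (u p 0) (v p 0) => x y z; lia.
apply: (@walk_trans _ _ (u + v)); last by apply: walk_step; rewrite // addrAC subrr add0r.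
apply: IH; rewrite // opprD addrA; last exact: latticeB.
by apply: leq_trans vlt _.
Qed.

Lemma pos_neg_partB v : pos_part v - neg_part v = v.
Proof.
apply/matrixP => p j; rewrite !mxE; move: (v p j) => z.
by have : Num.max z 0 - Num.max (- z) 0 = z by lia.
Qed.

Lemma pos_part_nonneg v : nonneg (pos_part v).
Proof. by apply/nonnegP => p; rewrite mxE le_max lexx orbT. Qed.

Lemma neg_part_nonneg v : nonneg (neg_part v).
Proof. by apply/nonnegP => p; rewrite mxE le_max lexx orbT. Qed.

(** A walk from v^+ to v^- inside the fiber has to jump from one to the other. *)
Lemma fiber2_indispensable M v : markov_basis D M -> lattice D v -> v <> 0 ->
  (forall x, nonneg x -> lattice D (pos_part v - x) ->
     x = pos_part v \/ x = neg_part v) ->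
  signed_mem M v.
Proof.
move=> [MD Mwalk] Dv v0 fib.
have [|s [sM sE sp]] := Mwalk _ _ (pos_part_nonneg v) (neg_part_nonneg v).
  by rewrite pos_neg_partB.
rewrite pos_neg_partB in sE.
elim: s sM sE sp => [_ sE|h s IH sM sE sp]; first by rewrite big_nil in sE.
have hM : signed_mem M h by apply: sM; rewrite mem_head.
have Dh : lattice D h.
  case: hM => [/MD//|hM]; rewrite -[h]opprK; apply: latticeN; exact: MD.
have := sp 1%N isT; rewrite /= take0 big_seq1 => wh0.
have [||wh|wh] := fib (pos_part v - h) => //; first by rewrite subKr.
  have h0 : h = 0 by apply/eqP; rewrite -oppr_eq0 -(addrI (pos_part v) (etrans wh (esym (addr0 _)))).
  apply: IH => [x xs||p ps].
  - by apply: sM; rewrite in_cons xs orbT.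
  - by rewrite sE big_cons h0 add0r.
  - by have := sp p.+1; rewrite /= big_cons h0 add0r; apply; case/andP: ps.
suff -> : v = h by [].
by rewrite -{1}(pos_neg_partB v) -wh subKr.
Qed.

(** Any minimal Markov basis contains the elements of R up to sign, and its
    elements of this kind already form a Markov basis, so it has no others. *)
Lemma universal_indispensableE R : markov_basis D R ->
  (forall M v, markov_basis D M -> v \in R -> signed_mem M v) ->
  (forall v, v \in R -> - v \in R -> v = - v) ->
  universal_markov D = sign_closure [set` R] /\
  indispensable D = sign_closure [set` R].
Proof.
move=> RD ind sgn.
have Rmin : minimal_markov_basis D R.
  split=> // M'; rewrite fproperE => /andP[/fsubsetP M'R /fsubsetPn[v vR vM']] M'D.
  move/negP: vM'; apply.
  have [//|vM] := ind _ _ M'D vR.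
  by rewrite (sgn v vR (M'R _ vM)).
have minE M : minimal_markov_basis D M -> sign_closure [set` M] = sign_closure [set` R].
  move=> [MD Mmin].
  have RM v : v \in R -> signed_mem M v by exact: ind.
  pose M' := [fset v in M | (v \in R) || (- v \in R)]%fset.
  have M'M : (M' `<=` M)%fset by apply/fsubsetP => v; rewrite !inE => /andP[].
  have M'D : markov_basis D M'.
    split=> [v /= vM'|]; first by apply: MD.1; exact: (fsubsetP M'M).
    move=> w u w0 u0 Dwu; have [s [sR sE sp]] := RD.2 _ _ w0 u0 Dwu.
    exists s; split=> // v /sR vR; rewrite !inE !opprK.
    have [/RM []|/RM []] := vR; rewrite ?opprK => vM.
    + by case: vR => vR; rewrite vM vR ?orbT; left.
    + by case: vR => vR; rewrite vM vR ?orbT; right.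
    + by case: vR => vR; rewrite vM vR ?orbT; right.
    + by case: vR => vR; rewrite vM vR ?orbT; left.
  have ME : M' = M.
    apply/eqP; rewrite eqEfsubset M'M /=; apply: contrapT => MM'.
    by apply: (Mmin M') M'D; rewrite fproperE M'M; exact/negP.
  apply/seteqP; split=> v /=; last first.
    by case=> /RM // /signed_memN; rewrite opprK.
  suff H x : x \in M -> x \in R \/ - x \in R.
    by case=> /H [?|?]; [left|right|right|left]; rewrite // -[v]opprK.
  by rewrite -ME !inE => /andP[_ /orP].
split; apply/seteqP; split=> v.
- by case=> M Mmin; rewrite minE.
- by exists R.
- exact.
- by move=> Rv M Mmin; rewrite minE.
Qed.

End Markov.

(** * Graver bases and conformal vectors *)

Section Graver.
Variables (m N : nat) (D : 'M[nat]_(m, N)).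
Implicit Types (u v w h z : 'cV[int]_N).

(** This is v^+ <= u^+ and v^- <= u^-. *)
Definition conformal v u : Prop := below v u /\ below (- v) (- u).

Lemma conformalN v u : conformal v u -> conformal (- v) (- u).
Proof. by case=> vu vu'; split; rewrite // !opprK. Qed.

Lemma conformal_refl u : conformal u u.
Proof. by split=> p _. Qed.

Lemma below_trans v w u : below v w -> below w u -> below v u.
Proof. by move=> vw wu p v0; have := vw p v0; have := wu p; lia. Qed.

Lemma conformal_trans v w u : conformal v w -> conformal w u -> conformal v u.
Proof. by move=> [a b] [c d]; split; [exact: below_trans c|exact: below_trans d]. Qed.

Lemma below_partsP v w :
  (pos_part (v + w) = pos_part v + pos_part w /\
   neg_part (v + w) = neg_part v + neg_part w) <-> conformal v (v + w).
Proof.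
split=> [[pE nE]|[vu vu']].
  split=> p; move/matrixP/(_ p 0): pE; move/matrixP/(_ p 0): nE; rewrite !mxE.
    by move: (v p 0) (w p 0) => x y; lia.
  by move: (v p 0) (w p 0) => x y; lia.
split; apply/matrixP => p j; have := vu p; have := vu' p; rewrite ord1 !mxE;
  move: (v p 0) (w p 0) => x y H H'.
  by have : Num.max (x + y) 0 = Num.max x 0 + Num.max y 0 by lia.
by have : Num.max (- (x + y)) 0 = Num.max (- x) 0 + Num.max (- y) 0 by lia.
Qed.

Lemma graverP h : graver_basis D h <-> [/\ lattice D h, h <> 0
  & forall z, lattice D z -> conformal z h -> z = 0 \/ z = h].
Proof.
split=> [[Dh h0 irr]|[Dh h0 irr]]; split=> //.
  move=> z Dz zh; have [->|/eqP z0] := eqVneq z 0; [by left|right].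
  apply: contrapT => zNh; apply: irr; exists z, (h - z).
  have [] := (below_partsP z (h - z)).2; first by rewrite addrC subrK.
  rewrite [z + _]addrC subrK => pE nE; split=> //; split; first exact: latticeB.
  by move/subr0_eq => hz; exact: zNh.
move=> [v [w [[Dv v0] [Dw w0] hE pE nE]]].
have vh : conformal v h by rewrite hE; apply/below_partsP; rewrite -hE.
have [//|vE] := irr v Dv vh.
by apply: w0; apply: (addrI v); rewrite -hE vE addr0.
Qed.

Lemma graverN h : graver_basis D h -> graver_basis D (- h).
Proof.
move=> /graverP[Dh h0 irr]; apply/graverP; split; first exact: latticeN.
  by move=> /eqP; rewrite oppr_eq0 => /eqP.
move=> z Dz zh; have [||/eqP|] := irr (- z); first exact: latticeN.
- by rewrite -[h]opprK; exact: conformalN.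
- by rewrite oppr_eq0 => /eqP; left.
- by move=> <-; right; rewrite opprK.
Qed.

Lemma l1_eq0 u : l1 u = 0%N -> u = 0.
Proof.
move=> /eqP; rewrite sum_nat_eq0 => /forallP u0; apply/matrixP => p j.
by rewrite ord1 mxE; apply/eqP; rewrite -absz_eq0; exact: u0.
Qed.

Lemma conformal_graver u : lattice D u -> u <> 0 ->
  exists2 h, graver_basis D h & conformal h u.
Proof.
have [k] := ubnP (l1 u); elim: k u => // k IH u uk Du u0.
have [Gu|/graverP Gu] := pselect (graver_basis D u).
  by exists u; last exact: conformal_refl.
have [z [Dz zu z0 zNu]] : exists z, [/\ lattice D z, conformal z u, z <> 0 & z <> u].
  apply: contrapT => nz; apply: Gu; split=> // z Dz zu.
  have [->|/eqP z0] := eqVneq z 0; [by left|right].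
  by apply: contrapT => zNu; apply: nz; exists z.
have lt : (l1 z < l1 u)%N.
  have l1uz : (l1 u = l1 z + l1 (u - z))%N.
    rewrite /l1 -big_split; apply: eq_bigr => p _ /=; rewrite !mxE.
    by case: zu => /(_ p) + /(_ p); rewrite !mxE; move: (u p 0) (z p 0) => x y; lia.
  suff : l1 (u - z) <> 0%N by lia.
  by move/l1_eq0/subr0_eq => uz; exact: zNu.
have [|h Gh hz] := IH z _ Dz z0; first by apply: leq_trans lt _.
by exists h => //; exact: conformal_trans zu.
Qed.

End Graver.

Section OneRow.
Local Open Scope classical_set_scope.
Variables (m : nat) (A : 'M[nat]_(1, m)).
Hypothesis A_gt0 : forall j, (0 < A ord0 j)%N.
Implicit Types (u v w h z : 'cV[int]_m).

Lemma lattice_nonpos z : lattice A z -> (forall p, z p 0 <= 0) -> z = 0.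
Proof.
move=> /lattice1E Az z0; apply/matrixP => p j; rewrite ord1 mxE.
have : \sum_j (A ord0 j)%:Z * - z j 0 = 0.
  by under eq_bigr do rewrite mulrN; rewrite sumrN Az oppr0.
move/psumr_eq0P => /(_ _ p isT); have := A_gt0 p; have := z0 p.
move=> zp Ap /(_ _)/eqP; rewrite mulf_eq0 oppr_eq0 => H.
suff : ((A ord0 p : int) == 0) || (z p 0 == 0) by rewrite (gt_eqF (_ : 0 < (A ord0 p)%:Z)) // => /eqP.
by apply: H => k _; apply: mulr_ge0; rewrite ?oppr_ge0.
Qed.

Lemma lattice_neg z : lattice A z -> z <> 0 -> exists p, z p 0 < 0.
Proof.
move=> Az z0; apply: contrapT => nz; apply: z0.
rewrite -[z]opprK (lattice_nonpos (latticeN Az)) ?oppr0 // => p.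
by rewrite mxE oppr_le0 leNgt; apply/negP => zp; apply: nz; exists p.
Qed.

Definition circuit p q : 'cV[int]_m :=
  \col_j ((j == p)%:R * (A ord0 q)%:Z - (j == q)%:R * (A ord0 p)%:Z).

Lemma lattice_circuit p q : lattice A (circuit p q).
Proof.
apply/lattice1E; under eq_bigr do rewrite mxE mulrBr.
rewrite sumrB (bigD1 p) //= [X in _ - X](bigD1 q) //= !eqxx !mul1r.
rewrite !big1 ?addr0; first by rewrite mulrC subrr.
  by move=> j /negPf->; rewrite mul0r mulr0.
by move=> j /negPf->; rewrite mul0r mulr0.
Qed.

(** If an entry h_p exceeds the sum of the weights, some entry h_q is smaller than
    - A_p, because the weighted sum vanishes; the circuit of p and q is then
    conformal to h, hence equal to h, whose entry at p is only A_q. *)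
Lemma graver_bound h p : graver_basis A h -> h p 0 <= (\sum_j A ord0 j)%N%:Z.
Proof.
move=> /graverP[Ah h0 irr]; set N := (\sum_j _)%N; rewrite leNgt; apply/negP => hp.
have leN j : (A ord0 j <= N)%N by rewrite /N (bigD1 j) //= leq_addr.
have [q hq] : exists q, h q 0 < - (A ord0 p)%:Z.
  apply: contrapT => nq.
  have ge q : - (A ord0 p)%:Z <= h q 0 by rewrite leNgt; apply/negP => hq; apply: nq; exists q.
  move/lattice1E: Ah; rewrite (bigD1 p) //= => /eqP; apply/negP; rewrite gt_eqF //.
  have : - (A ord0 p)%:Z * N%:Z <= \sum_(j | j != p) (A ord0 j)%:Z * h j 0.
    apply: (@le_trans _ _ (\sum_(j | j != p) (A ord0 j)%:Z * - (A ord0 p)%:Z)).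
      rewrite -mulr_suml mulrC ler_nM2r ?oppr_lt0 ?ltz_nat //.
      rewrite -(big_morph Posz PoszD (erefl _)) lez_nat /N [leqRHS](bigD1 p) //=.
      exact: leq_addl.
    by apply: ler_sum => j _; rewrite ler_wpM2l.
  move=> H; apply: lt_le_trans (lerD (lexx _) H).
  by rewrite mulNr -mulrBr mulr_gt0 ?subr_gt0 ?ltz_nat.
have pq : p != q by apply/eqP => pq; move: hp hq; rewrite pq; lia.
have [cE|cE] : circuit p q = 0 \/ circuit p q = h.
- apply: irr; first exact: lattice_circuit.
  split=> j; rewrite !mxE.
    case: (eqVneq j p) => [->|jp]; first by rewrite (negPf pq) /=; have := leN q; lia.
    by case: eqP => _ /=; lia.
  case: (eqVneq j q) => [->|jq]; last by case: eqP => _ /=; lia.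
  by rewrite eq_sym (negPf pq) /=; lia.
- move/matrixP/(_ p 0): cE; rewrite !mxE eqxx (negPf pq) /=.
  by have := A_gt0 q; lia.
move/matrixP/(_ p 0): cE; rewrite mxE eqxx (negPf pq) mul1r mul0r subr0.
by have := leN q; move: hp; lia.
Qed.

Lemma graver_finite : finite_set (graver_basis A).
Proof.
set N := (\sum_j A ord0 j)%N.
pose f (t : {ffun 'I_m -> 'I_(N + N).+1}) : 'cV[int]_m :=
  \col_j ((t j : nat)%:Z - N%:Z).
apply: (@sub_finite_set _ _ (f @` setT)); last exact: finite_image.
move=> h Gh; have hN p := graver_bound p Gh.
have hN' p := graver_bound p (graverN Gh).
exists [ffun j => inord `|(h j 0 + N%:Z)%R|%N] => //.
apply/matrixP => j k; rewrite ord1 mxE ffunE inordK.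
  have := hN' j; rewrite mxE -/N; move: (h j 0) => x xN.
  by have : `|(x + N%:Z)%R|%N%:Z - N%:Z = x by lia.
have := hN' j; have := hN j; rewrite mxE -/N; move: (h j 0) => x; lia.
Qed.

End OneRow.

(** * Descent steps of a combination of a Herzog basis *)

(** A proper nonempty subset of three indices is a singleton or the complement of
    one.  Suppose [set a] and the complement of [set b] are missing.  The member
    covering a is then the complement of some [set d], and the member avoiding b
    some [set e]; without a complementary pair d and e differ from each other
    and from a and b, so a = b, and there is no way left to cover d. *)
Lemma family_ord3 (P : {set 'I_3} -> Prop) :
  (forall S, P S -> S != finset.set0 /\ S != [set: 'I_3]%SET) ->
  (forall c, exists2 S, P S & c \in S) -> (forall c, exists2 S, P S & c \notin S) ->
  [\/ exists a, P [set a]%SET /\ P (~: [set a])%SET,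
      forall a, P [set a]%SET | forall a, P (~: [set a])%SET].
Proof.
move=> proper cover avoid.
have [?|nocompl] := pselect (exists a, P [set a]%SET /\ P (~: [set a])%SET).
  by constructor 1.
have {}nocompl a : P [set a]%SET -> ~ P (~: [set a])%SET.
  by move=> Pa Pca; apply: nocompl; exists a.
have shape S : P S -> exists a, S = [set a]%SET \/ S = (~: [set a])%SET.
  move=> /proper [S0 ST]; have : (#|S| == 1) || (#|~: S| == 1).
    have CT : (~: S)%SET != finset.set0 by rewrite -finset.setCT (inj_eq (@finset.setC_inj _)).
    by have := cardsC S; rewrite card_ord; move: S0 CT; rewrite -!card_gt0; lia.
  case/orP => /cards1P[a aE]; exists a; [by left|right].
  by rewrite -aE finset.setCK.
have [?|/existsNP[a na]] := pselect (forall a, P [set a]%SET); first by constructor 2.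
have [?|/existsNP[b nb]] := pselect (forall b, P (~: [set b])%SET); first by constructor 3.
exfalso.
have cov c : ~ P [set c]%SET -> exists2 d, d != c & P (~: [set d])%SET.
  move=> nc; have [S PS cS] := cover c; have [d [SE|SE]] := shape S PS; subst S.
    by move: cS PS; rewrite inE => /eqP<- /nc.
  by exists d => //; move: cS; rewrite !inE eq_sym.
have avo c : ~ P (~: [set c])%SET -> exists2 d, d != c & P [set d]%SET.
  move=> nc; have [S PS cS] := avoid c; have [d [SE|SE]] := shape S PS; subst S.
    by exists d => //; move: cS; rewrite inE eq_sym.
  by move: cS PS; rewrite !inE negbK => /eqP<- /nc.
have [d da Pd] := cov a na; have [e eb Pe] := avo b nb.
have de : d != e by apply/eqP => de; subst e; exact: (nocompl _ Pe Pd).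
have db : d != b by apply/eqP => db; subst d; exact: nb.
have ea : e != a by apply/eqP => ea; subst e; exact: na.
have ab : a = b.
  have [//|ab] := eqVneq a b.
  have [E|E|E] := ord3_cases e da db ab.
  - by rewrite E eqxx in de.
  - by rewrite E eqxx in ea.
  - by rewrite E eqxx in eb.
subst b.
have nd : ~ P [set d]%SET by move=> /nocompl.
have [f fd Pf] := cov d nd.
have [E|E|E] := ord3_cases f de da ea.
- by rewrite E eqxx in fd.
- by subst f; exact: nocompl Pe Pf.
- by subst f; exact: nb.
Qed.

Section Herzog.
Variables (A : 'M[nat]_(1, 3)) (g : 'I_3 -> 'cV[int]_3).
Hypothesis A_gt0 : forall j, (0 < A ord0 j)%N.
Hypothesis hg : herzog_basis A g.
Implicit Types (u v z : 'cV[int]_3) (t : 'I_3 -> int).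

Lemma herzog_col a b c : a != b -> a != c -> b != c ->
  g a a 0 + (g b a 0 + g c a 0) = 0.
Proof.
move=> ab ac bc; have /matrixP/(_ a 0) := herzog_sum hg.
by rewrite summxE (big_ord3 _ _ ab ac bc) mxE.
Qed.

Lemma herzog_neg a : g a a 0 < 0.
Proof.
have [b [c [ab ac bc]]] := ord3_others a; have := herzog_col ab ac bc.
have ba : b != a by rewrite eq_sym.
have ca : c != a by rewrite eq_sym.
by have := herzog_pos hg ba; have := herzog_pos hg ca; lia.
Qed.

Lemma herzog_lt a b : a != b -> g a b 0 < - g b b 0.
Proof.
move=> ab; have [c ac bc] := ord3_third ab.
have ba : b != a by rewrite eq_sym.
have cb : c != b by rewrite eq_sym.
by have := herzog_col ba bc ac; have := herzog_pos hg cb; lia.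
Qed.

(** If z_a < 0, apply minimality at a to z - g_a; if z_a = 0, minimality at another
    index b contradicts z_b <= g_ab < - g_bb. *)
Lemma below_herzog a z : lattice A z -> below z (g a) -> z = 0 \/ z = g a.
Proof.
move=> Az zg.
have za : z a 0 <= 0 by have := zg a; have := herzog_neg a; lia.
have [za0|za0] := ltrP (z a 0) 0.
  right; apply: subr0_eq; have Azg := latticeB Az (herzog_lattice hg a).
  have leb b : b != a -> (z - g a) b 0 <= 0.
    move=> ba; have ab : a != b by rewrite eq_sym.
    have := zg b; have := herzog_pos hg ab; rewrite !mxE.
    by move: (z b 0) (g a b 0) => x y; lia.
  apply: (lattice_nonpos A_gt0 Azg) => b.
  have [->|] := eqVneq b a; last exact: leb.
  rewrite leNgt; apply/negP => wa; have := herzog_min hg Azg wa leb.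
  by rewrite !mxE; move: za0; move: (z a 0) (g a a 0) => x y; lia.
left; have {za0} za0 : z a 0 = 0 by lia.
apply: (lattice_nonpos A_gt0 Az) => b; have [->|ba] := eqVneq b a; first by rewrite za0.
rewrite leNgt; apply/negP => zb.
have ab : a != b by rewrite eq_sym.
have [c ac bc] := ord3_third ab.
have zc : z c 0 <= 0.
  rewrite leNgt; apply/negP => zc.
  have /matrixP/(_ b 0) : - z = 0.
    apply: (lattice_nonpos A_gt0 (latticeN Az)) => d; rewrite mxE oppr_le0.
    by have [->|->|->] := ord3_cases d ab ac bc; rewrite ?za0 // ltW.
  by rewrite !mxE => /eqP; rewrite oppr_eq0 gt_eqF.
have := herzog_min hg Az zb; have := herzog_lt ab; have := zg b zb.
move=> H1 H2 H3; have : - g b b 0 <= z b 0; last by lia.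
apply: H3 => d db; have [->|E|->] := ord3_cases d ab ac bc; rewrite ?za0 //.
by rewrite E eqxx in db.
Qed.

Lemma graver_herzog a : graver_basis A (g a).
Proof.
apply/graverP; split; first exact: (herzog_lattice hg).
  by move/matrixP/(_ a 0); rewrite mxE; have := herzog_neg a; lia.
by move=> z Az [zg _]; exact: below_herzog.
Qed.

Definition herzog_comb t : 'cV[int]_3 := \sum_a t a *: g a.

(** It is invariant under adding a constant to t, as is [herzog_comb g t]. *)
Definition argmin t : {set 'I_3} := [set a | [forall b, t a <= t b]].

(** Since the g_a sum to zero, this is plus or minus one of them as soon as
    [argmin t] is proper. *)
Definition descent t : 'cV[int]_3 := \sum_(a | a \notin argmin t) g a.

Lemma argminP t a : reflect (forall b, t a <= t b) (a \in argmin t).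
Proof. by rewrite inE; exact: forallP. Qed.

Lemma argmin_neq0 t : argmin t != finset.set0.
Proof.
apply/finset.set0Pn; case: (@Order.TotalTheory.arg_minP _ _ _ ord0 xpredT t isT) => a _ am.
by exists a; apply/argminP => b; exact: am.
Qed.

(** At an index b where t is minimal, u_b is the sum of the (t_a - t_b) g_ab over
    the nonminimal a, with g_ab > 0 and t_a - t_b >= 1. *)
Lemma descent_argmin t b : argmin t != [set: 'I_3]%SET -> b \in argmin t ->
  0 < descent t b 0 <= herzog_comb t b 0.
Proof.
move=> tT bm; rewrite /descent summxE; apply/andP; split.
  have [a am] : exists a, a \notin argmin t.
    apply/existsP; rewrite -negb_forall; apply: contra tT => /forallP aT.
    by apply/eqP/finset.setP => a; rewrite aT inE.
  have pos d : d \notin argmin t -> 0 < g d b 0.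
    by move=> dm; apply: (herzog_pos hg); apply: contra dm => /eqP->.
  rewrite (bigD1 a) //= ltr_pwDl ?pos //.
  by apply: sumr_ge0 => d /andP[dm _]; exact/ltW/pos.
have -> : herzog_comb t = \sum_a (t a - t b) *: g a.
  under [RHS]eq_bigr do rewrite scalerBl.
  by rewrite sumrB -scaler_sumr (herzog_sum hg) scaler0 subr0.
rewrite summxE [leRHS](bigID (mem (argmin t))) /= [X in X + _]big1 ?add0r => [|a am].
  apply: ler_sum => a am; rewrite mxE.
  have gab : 0 < g a b 0 by apply: (herzog_pos hg); apply: contra am => /eqP->.
  rewrite ler_peMl ?(ltW gab) // -gtz0_ge1 subr_gt0.
  rewrite ltNge; apply: contra am => ab; apply/argminP => d.
  by apply: le_trans ab _; exact: (argminP _ _ bm).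
have -> : t a = t b by apply/eqP; rewrite eq_le (argminP _ _ am) (argminP _ _ bm).
by rewrite subrr scale0r mxE.
Qed.

(** The descent step is also minus the sum of the g_a over the minimal a, whose
    entries at b are positive. *)
Lemma descent_notin t b : b \notin argmin t -> descent t b 0 < 0.
Proof.
move=> bm.
have : descent t + \sum_(a in argmin t) g a = 0.
  by rewrite -[RHS](herzog_sum hg) [RHS](bigID (mem (argmin t))) addrC.
move/matrixP/(_ b 0); rewrite mxE summxE mxE => /eqP; rewrite addr_eq0 => /eqP->.
rewrite oppr_lt0; have /finset.set0Pn[a am] := argmin_neq0 t.
have pos d : d \in argmin t -> 0 < g d b 0.
  by move=> dm; apply: (herzog_pos hg); apply: contraTneq dm => ->.
rewrite (bigD1 a) //= ltr_pwDl ?pos //.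
by apply: sumr_ge0 => d /andP[dm _]; exact/ltW/pos.
Qed.

Lemma herzog_comb_neq0 t : argmin t != [set: 'I_3]%SET -> herzog_comb t <> 0.
Proof.
move=> tT; have /finset.set0Pn[b bm] := argmin_neq0 t.
move/matrixP/(_ b 0); rewrite mxE; have := descent_argmin tT bm; lia.
Qed.

Lemma herzog_comb_const t a b : herzog_comb t = 0 -> t a = t b.
Proof.
move=> t0; have tT : argmin t = [set: 'I_3]%SET.
  by apply/eqP; apply: contraPT t0; exact: herzog_comb_neq0.
have am c : forall b, t c <= t b by apply/argminP; rewrite tT inE.
by apply/eqP; rewrite eq_le !am.
Qed.

Lemma herzog_comb_argminT t : argmin t = [set: 'I_3]%SET -> herzog_comb t = 0.
Proof.
move=> tT; have am c : forall b, t c <= t b by apply/argminP; rewrite tT inE.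
have -> : 0 = t ord0 *: \sum_a g a by rewrite (herzog_sum hg) scaler0.
by rewrite scaler_sumr; apply: eq_bigr => a _; congr (_ *: _); apply/eqP; rewrite eq_le !am.
Qed.

Lemma herzog_combN t : herzog_comb (fun a => - t a) = - herzog_comb t.
Proof. by rewrite /herzog_comb -sumrN; apply: eq_bigr => a _; rewrite scaleNr. Qed.

Lemma herzog_comb_lattice t : lattice A (herzog_comb t).
Proof.
apply: lattice_sum => a _; rewrite /lattice /= -scalemxAr.
by have := herzog_lattice hg a; rewrite /lattice /= => ->; rewrite scaler0.
Qed.

Lemma below_descent t : argmin t != [set: 'I_3]%SET -> below (descent t) (herzog_comb t).
Proof.
move=> tT b vb; have bm : b \in argmin t.
  by rewrite -[_ \in _]negbK; apply/negP => /descent_notin; lia.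
by have /andP[] := descent_argmin tT bm.
Qed.

Lemma descent_meets_neg t : argmin t != [set: 'I_3]%SET ->
  exists p, descent t p 0 < 0 /\ herzog_comb t p 0 < 0.
Proof.
move=> tT; have [p up] := lattice_neg A_gt0 (herzog_comb_lattice t) (herzog_comb_neq0 tT).
exists p; split=> //; apply: descent_notin; apply/negP => /(descent_argmin tT); lia.
Qed.

End Herzog.

(** * Row by row description of Lawrence liftings *)

Section Rows.
Variables (n r : nat).
Implicit Types u v : 'cV[int]_(\sum_(i < r) n).

Lemma entry_submxcol u p : u p 0 = submxcol u (tagnat.sig1 p) (tagnat.sig2 p) 0.
Proof. by rewrite -{1}(submxcolK u) mxE. Qed.

Lemma submxcolP u v : (forall i, submxcol u i = submxcol v i) -> u = v.
Proof. by move/mxcolP. Qed.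

Lemma sum_entries u : \sum_p u p 0 = \sum_b (\sum_i submxcol u i) b 0.
Proof.
under [RHS]eq_bigr do rewrite summxE.
rewrite exchange_big sig_big_dep /= (reindex _ (tagnat.sig_bij_on (p_ := fun=> n))) /=.
by apply: eq_bigr => p _; rewrite entry_submxcol.
Qed.

Definition at_row (i : 'I_r) (h : 'cV[int]_n) : 'cV[int]_(\sum_(i < r) n) :=
  \mxcol_k (if k == i then h else 0).

Lemma submxcol_at_row i h k : submxcol (at_row i h) k = if k == i then h else 0.
Proof. by rewrite mxcolK. Qed.

Lemma at_rowN i h : at_row i (- h) = - at_row i h.
Proof.
apply: submxcolP => k; rewrite submxcolN !submxcol_at_row.
by case: eqP; rewrite ?oppr0.
Qed.

Lemma at_row0 i : at_row i 0 = 0.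
Proof. by apply: submxcolP => k; rewrite submxcol_at_row submxcol0; case: eqP. Qed.

Lemma submxcol_selection (I : finType) (f : I -> 'I_r) (V : I -> 'cV[int]_n) a :
  injective f -> submxcol (\sum_a at_row (f a) (V a)) (f a) = V a.
Proof.
move=> finj; rewrite submxcol_sum (bigD1 a) //= submxcol_at_row eqxx.
rewrite big1 ?addr0 // => b ba; rewrite submxcol_at_row (inj_eq finj).
by rewrite eq_sym (negPf ba).
Qed.

Lemma submxcol_selection0 (I : finType) (f : I -> 'I_r) (V : I -> 'cV[int]_n) k :
  (forall a, k != f a) -> submxcol (\sum_a at_row (f a) (V a)) k = 0.
Proof.
move=> kf; rewrite submxcol_sum big1 // => a _.
by rewrite submxcol_at_row (negPf (kf a)).
Qed.

Lemma sum_submxcol_selection (I : finType) (f : I -> 'I_r) (V : I -> 'cV[int]_n) :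
  \sum_i submxcol (\sum_a at_row (f a) (V a)) i = \sum_a V a.
Proof.
under eq_bigr do rewrite submxcol_sum.
rewrite exchange_big; apply: eq_bigr => a _ /=; rewrite (bigD1 (f a)) //=.
rewrite submxcol_at_row eqxx big1 ?addr0 // => k ka.
by rewrite submxcol_at_row (negPf ka).
Qed.

(** The matrix with row V a at place f a shortens u if each of its rows is below
    the corresponding row of u and one cancellation occurs among negative entries. *)
Lemma selection_move (I : finType) (f : I -> 'I_r) (V : I -> 'cV[int]_n) u :
  injective f -> (forall a, below (V a) (submxcol u (f a))) -> \sum_a V a = 0 ->
  (exists a p, V a p 0 < 0 /\ submxcol u (f a) p 0 < 0) ->
  let v := \sum_a at_row (f a) (V a) in below v u /\ (l1 (u - v) < l1 u)%N.
Proof.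
move=> finj Vu V0 [a [p [Vp up]]] v.
have vu : below v u.
  move=> q; rewrite !entry_submxcol; move: (tagnat.sig1 q) (tagnat.sig2 q) => k b.
  have [[c ->]|kf] := pselect (exists c, k = f c).
    by rewrite submxcol_selection //; exact: Vu.
  rewrite submxcol_selection0; first by rewrite mxE ltxx.
  by move=> c; apply/eqP => kc; apply: kf; exists c.
split=> //; apply: l1_below => //.
  by rewrite sum_entries sum_submxcol_selection V0; apply: big1 => b _; rewrite mxE.
exists (@tagnat.Rank _ (fun=> n) (f a) p); move: Vp up.
by rewrite -{1}(submxcol_selection V a finj) !mxE.
Qed.

End Rows.

Lemma lattice_lawrence m n (A : 'M[nat]_(m, n)) r (u : 'cV[int]_(\sum_(i < r) n)) :
  lattice (lawrence A r) u <->
  (forall i, lattice A (submxcol u i)) /\ \sum_i submxcol u i = 0.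
Proof.
pose B : 'M[int]_(\sum_(i < r) m + n, \sum_(j < r) n) :=
  col_mx (\mxblock_(i < r, j < r) (if i == j then map_mx Posz A else 0))
         (\mxrow_(j < r) 1%:M).
have BE : lattice (lawrence A r) u <-> B *m u = 0.
  rewrite /lattice /= (_ : map_mx Posz (lawrence A r) = B) //.
  rewrite map_col_mx; congr col_mx; apply/matrixP => i j; rewrite !mxE //.
    by case: eqP => _; rewrite !mxE.
  by case: eqP.
apply: (iff_trans BE); rewrite /B -{1}(submxcolK u) mul_col_mx mul_mxblock_mxrow mul_mxrow_mxcol.
have sumE : \sum_i 1%:M *m submxcol u i = \sum_i submxcol u i.
  by apply: eq_bigr => i _; rewrite mul1mx.
have blockE : \mxcol_i \sum_j (if i == j then map_mx Posz A else 0) *m submxcol u j =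
  \mxcol_i (map_mx Posz A *m submxcol u i) :> 'cV[int]_(\sum_(i < r) m).
  apply: eq_mxcol => i; rewrite (bigD1 i) //= eqxx big1 ?addr0 // => j ji.
  by rewrite eq_sym (negPf ji) mul0mx.
split=> [/eqP|[Au u0]].
  rewrite col_mx_eq0 => /andP[/eqP Xu /eqP u0]; rewrite -sumE; split=> // i.
  by have /mxcolP/(_ i) := etrans (esym blockE) Xu; rewrite mxcolK submxcol0.
apply/eqP; rewrite col_mx_eq0 sumE u0 eqxx andbT; apply/eqP.
apply: etrans blockE _; apply/mxcolP => i; rewrite mxcolK submxcol0; exact: Au.
Qed.

(** * Distance reduction for Lawrence liftings *)

Definition graver_move n r (i j : 'I_r) (h : 'cV[int]_n) := at_row i h - at_row j h.

Lemma graver_moveN n r (i j : 'I_r) (h : 'cV[int]_n) :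
  - graver_move i j h = graver_move j i h.
Proof. by rewrite opprB. Qed.

(** Two-row moves are put in the form required by [selection_move], with the
    booleans indexing the two rows. *)
Lemma graver_move_selection n r (i j : 'I_r) (h : 'cV[int]_n) :
  graver_move i j h = \sum_b at_row (if b then i else j) (if b then h else - h).
Proof. by rewrite big_bool /= at_rowN. Qed.

Lemma two_rows_inj r (i j : 'I_r) : i != j -> injective (fun b : bool => if b then i else j).
Proof. by move=> ij [] [] // ijE; move: ij; rewrite ijE eqxx. Qed.

Section Reduction.
Variables (A : 'M[nat]_(1, 3)) (g : 'I_3 -> 'cV[int]_3).
Hypothesis A_gt0 : forall j, (0 < A ord0 j)%N.
Hypothesis hg : herzog_basis A g.
Variable r : nat.
Implicit Types u v : 'cV[int]_(\sum_(i < r) 3).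

Definition herzog_move (f : 'I_3 -> 'I_r) : 'cV[int]_(\sum_(i < r) 3) :=
  \sum_a at_row (f a) (g a).

Variable M : {fset 'cV[int]_(\sum_(i < r) 3)}.
Hypothesis M_graver : forall i j h, i != j -> graver_basis A h ->
  signed_mem M (graver_move i j h).
Hypothesis M_herzog : forall f, injective f -> signed_mem M (herzog_move f).

Definition has_move u : Prop := exists v,
  [/\ signed_mem M v, below v u & (l1 (u - v) < l1 u)%N].

Lemma descent1 t a : argmin t = [set a]%SET -> descent g t = - g a.
Proof.
move=> tE; apply/eqP; rewrite -addr_eq0 addrC; apply/eqP.
rewrite -[RHS](herzog_sum hg) [RHS](bigD1 a) //= /descent tE.
by congr (_ + _); apply: eq_bigl => b; rewrite inE.
Qed.

Lemma descentC1 t a : argmin t = (~: [set a])%SET -> descent g t = g a.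
Proof.
move=> tE; rewrite /descent tE (eq_bigl (pred1 a)) ?big_pred1_eq // => b.
by rewrite !inE negbK.
Qed.

(** The condition of [family_ord3] gives rows whose descent steps sum to zero:
    g_a and - g_a, or the three - g_a, or the three g_a. *)
Lemma descent_move (t : 'I_r -> 'I_3 -> int) u :
  (forall i, submxcol u i = herzog_comb g (t i)) ->
  (forall c, exists2 i, argmin (t i) != [set: 'I_3]%SET & c \in argmin (t i)) ->
  (forall c, exists2 i, argmin (t i) != [set: 'I_3]%SET & c \notin argmin (t i)) ->
  has_move u.
Proof.
move=> uE cover avoid.
have pick (I : finType) (a : I) (f : I -> 'I_r) (V : I -> 'cV_3) : injective f ->
    (forall b, argmin (t (f b)) != [set: 'I_3]%SET) ->
    (forall b, descent g (t (f b)) = V b) -> \sum_b V b = 0 ->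
    signed_mem M (\sum_b at_row (f b) (V b)) -> has_move u.
  move=> finj fT fV V0 MV.
  have [|||vu vlt] := @selection_move _ _ _ f V u finj; last by exists (\sum_b at_row (f b) (V b)).
  - by move=> b; rewrite uE -fV; exact: (below_descent hg (fT b)).
  - exact: V0.
  by exists a; rewrite uE -fV; exact: (descent_meets_neg A_gt0 hg (fT a)).
pose P S := exists i, argmin (t i) = S /\ argmin (t i) != [set: 'I_3]%SET.
have : [\/ exists a, P [set a]%SET /\ P (~: [set a])%SET,
    forall a, P [set a]%SET | forall a, P (~: [set a])%SET].
  apply: family_ord3 => [S [i [<- iT]]|c|c]; first by rewrite argmin_neq0.
    by have [i iT ci] := cover c; exists (argmin (t i)) => //; exists i.
  by have [i iT ci] := avoid c; exists (argmin (t i)) => //; exists i.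
case=> [[a [[i [iE iT]] [j [jE jT]]]]|/choice[f fP]|/choice[f fP]].
- have ji : j != i.
    apply/eqP => ji; move: jE; rewrite ji iE => /finset.setP/(_ a).
    by rewrite !inE eqxx.
  apply: (pick _ true (fun b : bool => if b then j else i)
            (fun b : bool => if b then g a else - g a)).
  + exact: two_rows_inj.
  + by case.
  + by case; [exact: descentC1|exact: descent1].
  + by rewrite big_bool /= subrr.
  by rewrite -graver_move_selection; apply: M_graver => //; exact: (graver_herzog A_gt0 hg).
- have finj : injective f.
    move=> a b fab; have [aE _] := fP a; have [bE _] := fP b.
    by apply/eqP; rewrite -finset.in_set1 -bE -fab aE inE.
  apply: (pick _ ord0 f (fun a => - g a)) => //.
  + by move=> a; have [_] := fP a.
  + by move=> a; apply: descent1; have [] := fP a.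
  + by rewrite sumrN (herzog_sum hg) oppr0.
  have -> : \sum_a at_row (f a) (- g a) = - herzog_move f.
    by rewrite -sumrN; apply: eq_bigr => a _; rewrite at_rowN.
  by apply: signed_memN; exact: M_herzog.
- have finj : injective f.
    move=> a b fab; have [aE _] := fP a; have [bE _] := fP b.
    move: aE; rewrite fab bE => /finset.setC_inj/finset.set1_inj; exact: esym.
  apply: (pick _ ord0 f g) => //.
  + by move=> a; have [_] := fP a.
  + by move=> a; apply: descentC1; have [] := fP a.
  + exact: herzog_sum hg.
  exact: M_herzog.
Qed.

(** Under these conditions the move with rows h and - h shortens a matrix with rows
    w and z. *)
Definition opposed (h w z : 'cV[int]_3) : Prop :=
  [/\ below h w, below (- h) z
    & exists p, h p 0 < 0 /\ w p 0 < 0 \/ (- h) p 0 < 0 /\ z p 0 < 0].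

Lemma opposed_move i j h u : i != j -> graver_basis A h ->
  opposed h (submxcol u i) (submxcol u j) -> has_move u.
Proof.
move=> ij Gh [hi hj [p hp]]; exists (graver_move i j h).
have [|||vu vlt] := @selection_move _ _ _ (fun b : bool => if b then i else j)
  (fun b : bool => if b then h else - h) u (two_rows_inj ij).
- by case.
- by rewrite big_bool /= subrr.
- by case: hp => hp; [exists true, p|exists false, p].
by split; [exact: M_graver|rewrite graver_move_selection|rewrite graver_move_selection].
Qed.

(** Both w and - z have b as their only position with a negative entry.  If it is
    smaller in absolute value in w, a Graver element h conformal to w has its
    negative part below z; otherwise one conformal to - z works for the opposite
    matrix. *)
Lemma opposed_exists_neg w z a b c : a != b -> a != c -> b != c ->
  lattice A w -> lattice A z ->
  0 < w a 0 -> w b 0 < 0 -> z a 0 < 0 -> 0 < z b 0 -> 0 <= w c 0 -> z c 0 <= 0 ->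
  exists2 h, graver_basis A h & opposed h w z \/ opposed (- h) (- w) (- z).
Proof.
move=> ab ac bc Aw Az wa wb za zb wc zc.
have neq0 (x : 'cV[int]_3) p : x p 0 != 0 -> x <> 0.
  by move=> xp x0; move: xp; rewrite x0 mxE eqxx.
have single h x (y : 'cV[int]_3) : graver_basis A h -> conformal h x ->
    (forall p, x p 0 < 0 -> p = b) -> - x b 0 <= y b 0 -> opposed h x y.
  move=> /graverP[Ah h0 _] [hx hx'] xb xy.
  have hb p : h p 0 < 0 -> p = b /\ x b 0 <= h b 0.
    move=> hp; have := hx' p; rewrite !mxE oppr_gt0 lerN2 => /(_ hp) xh.
    by have pb := xb p (le_lt_trans xh hp); move: xh; rewrite pb.
  split=> // [p|]; first by rewrite mxE oppr_gt0 => /hb[-> ?]; apply: le_trans xy; rewrite lerN2.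
  have [p hp] := lattice_neg A_gt0 Ah h0.
  exists p; left; move: (hp) => /hb[pb xh]; rewrite pb in hp *.
  by split=> //; exact: le_lt_trans xh hp.
have [le|le] := lerP (- w b 0) (z b 0).
  have [h Gh hw] := conformal_graver Aw (neq0 w b (ltr0_neq0 wb)).
  exists h => //; left; apply: single => // p.
  by have [->|->|->] := ord3_cases p ab ac bc => //; lia.
have z0 : - z <> 0 by apply: (neq0 _ b); rewrite mxE oppr_eq0 gt_eqF.
have [h Gh hz] := conformal_graver (latticeN Az) z0.
exists h => //; right.
have [||zh hw [p hp]] := single h (- z) (- w) Gh hz.
- move=> p; rewrite mxE oppr_lt0; have [->|->|->] := ord3_cases p ab ac bc => // zp.
    by have := lt_trans zp za; rewrite ltxx.
  by have := lt_le_trans zp zc; rewrite ltxx.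
- by rewrite !mxE opprK; apply: ltW.
by split; rewrite ?opprK //; exists p; case: hp; [right|left].
Qed.

(** The second sign pattern is the first one for - w, - z, with a and b exchanged. *)
Lemma opposed_exists w z a b c : a != b -> a != c -> b != c ->
  lattice A w -> lattice A z ->
  0 < w a 0 -> w b 0 < 0 -> z a 0 < 0 -> 0 < z b 0 ->
  (0 <= w c 0 /\ z c 0 <= 0) \/ (w c 0 <= 0 /\ 0 <= z c 0) ->
  exists2 h, graver_basis A h & opposed h w z \/ opposed (- h) (- w) (- z).
Proof.
move=> ab ac bc Aw Az wa wb za zb [[wc zc]|[wc zc]].
  exact: (@opposed_exists_neg _ _ a b c).
have ba : b != a by rewrite eq_sym.
have [||||||h Gh H] := @opposed_exists_neg (- w) (- z) b a c ba bc ac (latticeN Aw) (latticeN Az);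
  rewrite ?mxE ?oppr_gt0 ?oppr_lt0 ?oppr_ge0 ?oppr_le0 //.
exists (- h); first exact: graverN.
by move: H; rewrite !opprK; case; [right|left].
Qed.

Lemma sum_entry0 (x : 'I_r -> 'cV[int]_3) (b : 'I_3) :
  \sum_i x i = 0 -> \sum_i x i b 0 = 0.
Proof. by move=> /matrixP/(_ b 0); rewrite summxE mxE. Qed.

Lemma sum0_exists_ge (I : finType) (P : pred I) (x : I -> int) : \sum_i x i = 0 ->
  (forall i, ~~ P i -> x i = 0) -> (exists i, P i) -> exists2 i, P i & 0 <= x i.
Proof.
move=> x0 xP [i0 Pi0]; apply: contrapT => nex.
have neg i : P i -> x i < 0.
  by move=> Pi; rewrite ltNge; apply/negP => xi; apply: nex; exists i.
move: x0; apply/eqP; rewrite lt_eqF // (bigD1 i0) //= ltr_nwDl ?neg //.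
by apply: sumr_le0 => i _; case: (boolP (P i)) => [/neg/ltW|/xP->].
Qed.

(** Among the nonzero rows, whose entries at c sum to zero, one has a nonnegative
    and one a nonpositive entry at c; if these two have the same signs at a and b,
    any row of the other kind can be paired with one of them. *)
Lemma two_sign_move u a b c : a != b -> a != c -> b != c ->
  lattice (lawrence A r) u -> u <> 0 ->
  (forall i, submxcol u i <> 0 ->
     (0 < submxcol u i a 0 /\ submxcol u i b 0 < 0) \/
     (submxcol u i a 0 < 0 /\ 0 < submxcol u i b 0)) ->
  has_move u \/ has_move (- u).
Proof.
move=> ab ac bc /lattice_lawrence[Au sum0] u0 sgn.
set x := submxcol u in Au sum0 sgn *.
have [i0 xi0] : exists i, x i != 0.
  apply/existsP; apply: contra_notT u0; rewrite negb_exists => /forallP z.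
  by apply: submxcolP => i; rewrite submxcol0; apply/eqP; rewrite -[_ == _]negbK.
have ex (e : 'I_3) (s : int) : exists2 i, x i <> 0 & 0 <= s * x i e 0.
  have [|||i /eqP] := @sum0_exists_ge _ (fun i => x i != 0) (fun i => s * x i e 0); last by exists i.
  - by rewrite -mulr_sumr sum_entry0 ?mulr0.
  - by move=> i; rewrite negbK => /eqP->; rewrite mxE mulr0.
  by exists i0.
have moves i j : 0 < x i a 0 -> x i b 0 < 0 -> x j a 0 < 0 -> 0 < x j b 0 ->
    (0 <= x i c 0 /\ x j c 0 <= 0) \/ (x i c 0 <= 0 /\ 0 <= x j c 0) ->
    has_move u \/ has_move (- u).
  move=> ia ib ja jb ijc.
  have ij : i != j by apply/eqP => ij; move: ia ja; rewrite ij; lia.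
  have [h Gh] := opposed_exists ab ac bc (Au i) (Au j) ia ib ja jb ijc.
  case=> H; [left|right]; first exact: opposed_move ij Gh H.
  by apply: opposed_move ij (graverN Gh) _; rewrite !submxcolN.
have [i /sgn si] := ex a 1; rewrite mul1r => ia.
have [j /sgn sj] := ex a (-1); rewrite mulN1r oppr_ge0 => ja.
have [p /sgn sp] := ex c 1; rewrite mul1r => pc.
have [q /sgn sq] := ex c (-1); rewrite mulN1r oppr_ge0 => qc.
have {si ia} [ia ib] : 0 < x i a 0 /\ x i b 0 < 0 by case: si => // -[]; lia.
have {sj ja} [ja jb] : x j a 0 < 0 /\ 0 < x j b 0 by case: sj => // -[]; lia.
case: sp sq => -[pa pb] [] [qa qb].
- have [jc|jc] := lerP 0 (x j c 0); last by apply: (moves p j) => //; left; split; lia.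
  by apply: (moves q j) => //; right.
- by apply: (moves p q) => //; left.
- by apply: (moves q p) => //; right.
- have [ic|ic] := lerP 0 (x i c 0); first by apply: (moves i q) => //; left.
  by apply: (moves i p) => //; right; split; lia.
Qed.

Section Coefficients.
Variables (u : 'cV[int]_(\sum_(i < r) 3)) (t : 'I_r -> 'I_3 -> int).
Hypothesis tE : forall i, submxcol u i = herzog_comb g (t i).
Hypothesis sum0 : \sum_i submxcol u i = 0.

Lemma row_neq0 i : (argmin (t i) != [set: 'I_3]%SET) = (submxcol u i != 0).
Proof.
rewrite tE; apply/idP/idP => [/(herzog_comb_neq0 hg)/eqP//|/eqP t0].
by apply/eqP => /(herzog_comb_argminT hg).
Qed.

(** Differences of coefficients are linear functionals of the rows, hence sum
    to zero: they cannot be of constant sign unless they vanish. *)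
Lemma coef_balance a b : (forall i, submxcol u i <> 0 -> t i a <= t i b) ->
  forall i, t i a = t i b.
Proof.
move=> le i; have : \sum_i (t i b - t i a) = 0.
  rewrite sumrB; apply/eqP; rewrite subr_eq0; apply/eqP.
  apply: (herzog_comb_const hg (t := fun a => \sum_i t i a)); rewrite -[RHS]sum0.
  under [RHS]eq_bigr do rewrite tE.
  rewrite /herzog_comb exchange_big; apply: eq_bigr => d _ /=.
  by rewrite scaler_suml.
move/psumr_eq0P => /(_ _ i isT) H; apply/esym/eqP; rewrite -subr_eq0; apply/eqP/H.
move=> k _; rewrite subr_ge0; have [uk|/eqP uk] := eqVneq (submxcol u k) 0.
  by rewrite (herzog_comb_const hg a b (t := t k)) // -tE.
exact: le.
Qed.

(** If all nonzero rows had a common minimal index c, then the differences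
    t_ia - t_ic would be nonnegative with zero sum, so all rows would vanish. *)
Lemma descent_or_avoid : u <> 0 ->
  has_move u \/ exists c, forall i, submxcol u i <> 0 -> c \notin argmin (t i).
Proof.
move=> u0; have [?|nav] := pselect (exists c, forall i, submxcol u i <> 0 -> c \notin argmin (t i)).
  by right.
left; apply: (descent_move tE) => c; apply: contrapT => nex.
  apply: nav; exists c => i /eqP ui; apply/negP => ci.
  by apply: nex; exists i; rewrite ?row_neq0.
apply: u0; apply: submxcolP => i; rewrite submxcol0; apply/eqP.
rewrite -[_ == _]negbK -row_neq0 negbK; apply/eqP/finset.setP => a; rewrite finset.in_setT.
have tc k b : submxcol u k <> 0 -> t k c <= t k b.
  move=> /eqP uk; apply: (elimT (argminP _ _)); rewrite -[_ \in _]negbK; apply/negP => ck.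
  by apply: nex; exists k; rewrite ?row_neq0.
apply/argminP => b; rewrite -(coef_balance (fun k => tc k a)).
by rewrite (coef_balance (fun k => tc k b)).
Qed.

Lemma min_coef_pos i a : submxcol u i <> 0 -> (forall b, t i a <= t i b) ->
  0 < submxcol u i a 0.
Proof.
move=> /eqP; rewrite -row_neq0 => tT /argminP ai; rewrite tE.
by have /andP[] := descent_argmin hg tT ai; exact: lt_le_trans.
Qed.

End Coefficients.

Lemma row_reduction u : lattice (lawrence A r) u -> u <> 0 ->
  has_move u \/ has_move (- u).
Proof.
move=> Lu u0; have /lattice_lawrence[Au sum0] := Lu.
have /choice[t tE] i : exists t, submxcol u i = herzog_comb g t.
  by have [t tE] := herzog_span hg (Au i); exists t.
pose t' i a := - t i a.
have t'E i : submxcol (- u) i = herzog_comb g (t' i).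
  by rewrite submxcolN tE herzog_combN.
have sum0' : \sum_i submxcol (- u) i = 0.
  by under eq_bigr do rewrite submxcolN; rewrite sumrN sum0 oppr0.
have u0' : - u <> 0 by move=> /eqP; rewrite oppr_eq0 => /eqP.
have neq0N i : submxcol u i <> 0 -> submxcol (- u) i <> 0.
  by move=> ui /eqP; rewrite submxcolN oppr_eq0 => /eqP.
have [|[c notmin]] := descent_or_avoid tE sum0 u0; first by left.
have [|[d notmax]] := descent_or_avoid t'E sum0' u0'; first by right.
have lowc i : submxcol u i <> 0 -> exists e, t i e < t i c.
  move=> /notmin; rewrite inE negb_forall => /existsP[e]; rewrite -ltNge => ?.
  by exists e.
have highd i : submxcol u i <> 0 -> exists f, t i d < t i f.
  move=> /neq0N/notmax; rewrite inE negb_forall => /existsP[f].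
  by rewrite lerN2 -ltNge => ?; exists f.
have [cd|cd] := eqVneq c d; last first.
  (* if t_c <= t_d, only e can be below t_c and only e can be above t_d *)
  have [e ce de] := ord3_third cd.
  have dc i : submxcol u i <> 0 -> t i d < t i c.
    move=> ui; have [x xc] := lowc i ui; have [y dy] := highd i ui.
    rewrite ltNge; apply/negP => cled; move: xc dy.
    have [->|->|->] := ord3_cases x cd ce de; have [->|->|->] := ord3_cases y cd ce de; lia.
  case: u0; apply: submxcolP => i; rewrite submxcol0; apply: contrapT => ui.
  have := dc i ui; rewrite (coef_balance tE sum0 (a := d) (b := c)) ?ltxx // => k uk.
  exact/ltW/dc.
subst d; have [a [b [ca cb ab]]] := ord3_others c.
have ac : a != c by rewrite eq_sym.
have bc : b != c by rewrite eq_sym.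
have sgn i x y : x != y -> x != c -> y != c -> submxcol u i <> 0 ->
    t i x < t i c -> t i c < t i y -> 0 < submxcol u i x 0 /\ submxcol u i y 0 < 0.
  move=> xy xc yc ui txc tcy; split.
    apply: (min_coef_pos tE) => // z.
    by have [->|->|->] := ord3_cases z xy xc yc; lia.
  have := @min_coef_pos _ _ t'E i y (neq0N i ui).
  rewrite submxcolN mxE oppr_gt0; apply => z; rewrite lerN2.
  by have [->|->|->] := ord3_cases z xy xc yc; lia.
apply: (two_sign_move ab ac bc Lu u0) => i ui.
have ba : b != a by rewrite eq_sym.
have [x xc] := lowc i ui; have [y cy] := highd i ui.
have [E|E|E] := ord3_cases x ab ac bc; subst x;
  have [E|E|E] := ord3_cases y ab ac bc; subst y; try lia.
- by left; exact: sgn.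
- by right; have [] := sgn i b a ba bc ac ui xc cy.
Qed.

Lemma markov_lawrence : ([set` M] `<=` lattice (lawrence A r))%classic ->
  markov_basis (lawrence A r) M.
Proof.
move=> ML; apply: markov_of_reduction => // u Lu u0.
have [[v [Mv vu vlt]]|[v [Mv vu vlt]]] := row_reduction Lu u0; first by exists v; split=> //; left.
exists (- v); split; [exact: signed_memN|by right; rewrite opprK|].
by rewrite -(l1N u) -l1N opprB addrC.
Qed.

End Reduction.

(** * Indispensability of the two kinds of moves *)

(** The points of the fiber of v^+ are the v^+ - y with y below v. *)
Lemma below_indispensable m N (D : 'M[nat]_(m, N)) M v :
  markov_basis D M -> lattice D v -> v <> 0 ->
  (forall y, lattice D y -> below y v -> y = 0 \/ y = v) -> signed_mem M v.
Proof.
move=> MD Dv v0 only; apply: (fiber2_indispensable MD Dv v0) => x x0 Dx.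
have yv : below (pos_part v - x) v.
  move=> p; have /nonnegP/(_ p) := x0; rewrite !mxE.
  by move: (x p 0) (v p 0) => a b; lia.
have [/subr0_eq->|yE] := only _ Dx yv; [by left|right].
by rewrite -(subKr (pos_part v) x) yE -{2}(pos_neg_partB v) subKr.
Qed.

Section Indispensability.
Variables (A : 'M[nat]_(1, 3)) (g : 'I_3 -> 'cV[int]_3).
Hypothesis A_gt0 : forall j, (0 < A ord0 j)%N.
Hypothesis hg : herzog_basis A g.
Variable r : nat.
Implicit Types u v : 'cV[int]_(\sum_(i < r) 3).

Lemma lattice_selection (I : finType) (f : I -> 'I_r) (V : I -> 'cV[int]_3) :
  injective f -> (forall a, lattice A (V a)) -> \sum_a V a = 0 ->
  lattice (lawrence A r) (\sum_a at_row (f a) (V a)).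
Proof.
move=> finj VA V0; apply/lattice_lawrence; split; last by rewrite sum_submxcol_selection.
move=> i; rewrite submxcol_sum; apply: lattice_sum => a _.
by rewrite submxcol_at_row; case: eqP => // _; exact: lattice0.
Qed.

Lemma lattice_graver_move (i j : 'I_r) h : i != j -> lattice A h ->
  lattice (lawrence A r) (graver_move i j h).
Proof.
move=> ij Ah; rewrite graver_move_selection; apply: lattice_selection.
- exact: two_rows_inj.
- by case=> //; exact: latticeN.
- by rewrite big_bool /= subrr.
Qed.

Lemma lattice_herzog_move (f : 'I_3 -> 'I_r) : injective f ->
  lattice (lawrence A r) (herzog_move g f).
Proof.
move=> finj; apply: lattice_selection => //; first exact: herzog_lattice hg.
exact: herzog_sum hg.
Qed.

Lemma below_submxcol u v i : below u v -> below (submxcol u i) (submxcol v i).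
Proof. by move=> uv b; rewrite !mxE; exact: uv. Qed.

Lemma below_selection0 (I : finType) (f : I -> 'I_r) (V : I -> 'cV[int]_3) y k :
  lattice (lawrence A r) y -> below y (\sum_a at_row (f a) (V a)) ->
  (forall a, k != f a) -> submxcol y k = 0.
Proof.
move=> /lattice_lawrence[Ay _] yv kf; apply: (lattice_nonpos A_gt0 (Ay k)) => b.
rewrite leNgt; apply/negP => yb; have := below_submxcol (i := k) yv yb.
by rewrite submxcol_selection0 // [leRHS]mxE => /(lt_le_trans yb); rewrite ltxx.
Qed.

Lemma below_selection (I : finType) (f : I -> 'I_r) (V : I -> 'cV[int]_3) y a :
  injective f -> below y (\sum_a at_row (f a) (V a)) ->
  below (submxcol y (f a)) (V a).
Proof. by move=> finj /(below_submxcol (i := f a)); rewrite submxcol_selection. Qed.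

Lemma sum_selected (I : finType) (f : I -> 'I_r) (y : 'cV[int]_(\sum_(i < r) 3)) : injective f ->
  (forall k, (forall a, k != f a) -> submxcol y k = 0) ->
  y = \sum_a at_row (f a) (submxcol y (f a)).
Proof.
move=> finj y0; apply: submxcolP => k.
have [[a ->]|kf] := pselect (exists a, k = f a); first by rewrite submxcol_selection.
have {}kf a : k != f a by apply/eqP => ka; apply: kf; exists a.
by rewrite submxcol_selection0 // y0.
Qed.

(** Rows outside i and j are nonpositive lattice vectors, hence zero; the row at i
    is then conformal to h. *)
Lemma graver_move_indispensable M (i j : 'I_r) h :
  markov_basis (lawrence A r) M -> i != j -> graver_basis A h ->
  signed_mem M (graver_move i j h).
Proof.
move=> MD ij /graverP[Ah h0 irr].
have finj := two_rows_inj ij.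
apply: (below_indispensable MD); first exact: lattice_graver_move.
  move=> v0; apply: h0; have := congr1 (fun v => submxcol v i) v0.
  by rewrite submxcolB !submxcol_at_row eqxx (negPf ij) subr0 submxcol0.
rewrite graver_move_selection => y Ly yv.
have yE := sum_selected finj (fun k => below_selection0 (k := k) Ly yv).
have [Ay ysum] := (lattice_lawrence A y).1 Ly.
have yi := below_selection (a := true) finj yv.
have yj := below_selection (a := false) finj yv.
have yji : submxcol y j = - submxcol y i.
  apply/eqP; rewrite -addr_eq0 addrC; apply/eqP.
  by rewrite -[RHS]ysum {3}yE sum_submxcol_selection big_bool.
rewrite /= yji in yj; rewrite [X in X = 0 \/ _]yE.
have [y0|yh] := irr _ (Ay i) (conj yi yj).
  by left; apply: big1 => -[] _; rewrite ?yji y0 ?oppr0 at_row0.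
by right; rewrite [LHS]yE; apply: eq_bigr => -[] _; rewrite ?yji yh.
Qed.

(** The rows are 0 or g_a by [below_herzog], and they sum to zero only if all of
    them are 0 or none is. *)
Lemma herzog_move_indispensable M (f : 'I_3 -> 'I_r) :
  markov_basis (lawrence A r) M -> injective f -> signed_mem M (herzog_move g f).
Proof.
move=> MD finj; apply: (below_indispensable MD); first exact: lattice_herzog_move.
  move=> v0; have := congr1 (fun v => submxcol v (f ord0) ord0 0) v0.
  rewrite submxcol_selection // submxcol0 mxE.
  by have := herzog_neg hg ord0; lia.
move=> y Ly yv; have yE := sum_selected finj (fun k => below_selection0 (k := k) Ly yv).
have [Ay ysum] := (lattice_lawrence A y).1 Ly.
(* the rows of y are s_a g_a with s_a in {0, 1}, and the sum of the s_a g_a vanishes *)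
pose s a : int := (submxcol y (f a) != 0)%:R.
have sE a : submxcol y (f a) = s a *: g a.
  have [y0|yg] := below_herzog A_gt0 hg (Ay (f a)) (below_selection (a := a) finj yv).
    by rewrite /s y0 eqxx scale0r.
  rewrite /s yg; case: eqVneq => [->|_]; first by rewrite scaler0.
  by rewrite scale1r.
have scst a b : s a = s b.
  apply: (herzog_comb_const hg); rewrite -[RHS]ysum {1}yE sum_submxcol_selection.
  by apply: eq_bigr => d _; rewrite sE.
rewrite yE; have [s0|s1] := eqVneq (submxcol y (f ord0)) 0; [left|right].
  by apply: big1 => a _; rewrite sE (scst a ord0) /s s0 eqxx scale0r at_row0.
by apply: eq_bigr => a _; rewrite sE (scst a ord0) /s s1 scale1r.
Qed.

Lemma lawrence_typeN u : lawrence_type (- u) = lawrence_type u.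
Proof.
by apply: eq_card => i; rewrite !inE submxcolN oppr_eq0.
Qed.

Lemma lawrence_type_selection (I : finType) (f : I -> 'I_r) (V : I -> 'cV[int]_3) :
  injective f -> (forall a, V a <> 0) ->
  lawrence_type (\sum_a at_row (f a) (V a)) = #|I|.
Proof.
move=> finj V0; rewrite /lawrence_type -(card_imset xpredT finj); apply: eq_card => k.
rewrite inE; apply/idP/imsetP => [|[a _ ->]]; last by rewrite submxcol_selection //; apply/eqP.
have [[a ->] _|kf] := pselect (exists a, k = f a); first by exists a.
rewrite submxcol_selection0 ?eqxx // => a.
by apply/eqP => ka; apply: kf; exists a.
Qed.

Lemma lawrence_type_graver (i j : 'I_r) (h : 'cV[int]_3) : i != j -> h <> 0 ->
  @lawrence_type r 3 (graver_move i j h) = 2%N.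
Proof.
move=> ij h0; rewrite graver_move_selection lawrence_type_selection ?card_bool //.
  exact: two_rows_inj.
by case=> // /eqP; rewrite oppr_eq0 => /eqP.
Qed.

Lemma lawrence_type_herzog f : injective f -> @lawrence_type r 3 (herzog_move g f) = 3%N.
Proof.
move=> finj; rewrite lawrence_type_selection ?card_ord // => a.
by move/matrixP/(_ a 0); rewrite mxE; have := herzog_neg hg a; lia.
Qed.

End Indispensability.

(** * Counting up to sign *)

Definition sign_reduced (T : zmodType) (R : seq T) : Prop :=
  forall v w, v \in R -> w \in R -> w = v \/ w = - v -> w = v.

Lemma card_up_to_sign_seq (T : zmodType) (R : seq T) (S : set T) :
  uniq R -> sign_reduced R -> (forall v, v \in R -> S v) ->
  (forall v, S v -> v \in R \/ - v \in R) -> card_up_to_sign S (size R).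
Proof.
move=> Ru Rs RS SR; rewrite /card_up_to_sign.
have -> : [set ([set v; - v])%classic | v in S]%classic
    = [set ([set v; - v])%classic | v in [set` R]]%classic.
  apply/seteqP; split=> _ [v Sv <-]; last by exists v => //; exact: RS.
  have [vR|vR] := SR _ Sv; first by exists v.
  by exists (- v) => //; rewrite opprK setUC.
apply: card_eq_trans (inj_card_eq _) _.
  move=> v w; rewrite !inE /= => vR wR vw.
  have : [set v; - v]%classic w by rewrite vw; left.
  by move=> /(Rs v w vR wR).
have -> : [set` R]%classic = [set` seq_fset tt R]%classic.
  by apply/seteqP; split=> v; rewrite /mkset seq_fsetE.
by apply/card_eq_fsetP; rewrite size_seq_fset undup_id.
Qed.

(** The operator [choose] depends only on the extension of its predicate, so that
    v and - v receive the same representative. *)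
Definition sign_rep (T : zmodType) (v : T) : bool := choose (pred2 v (- v)) v == v.

Lemma sign_repP (T : zmodType) (v : T) : sign_rep v || sign_rep (- v).
Proof.
rewrite /sign_rep opprK (@eq_choose _ (pred2 (- v) v) (pred2 v (- v))); last first.
  by move=> w /=; rewrite orbC.
rewrite (@choose_id _ _ (- v) v) /= ?eqxx ?orbT //.
by have /= := @chooseP _ (pred2 v (- v)) v; rewrite eqxx; exact.
Qed.

Lemma sign_rep_inj (T : zmodType) (v : T) : sign_rep v -> sign_rep (- v) -> v = - v.
Proof.
rewrite /sign_rep opprK (@eq_choose _ (pred2 (- v) v) (pred2 v (- v))); last first.
  by move=> w /=; rewrite orbC.
rewrite (@choose_id _ _ (- v) v) /= ?eqxx ?orbT // => /eqP E1 /eqP E2.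
by rewrite -{1}E1.
Qed.

Lemma card_ltn_pairs r : #|[pred p : 'I_r * 'I_r | (p.1 < p.2)%N]| = 'C(r, 2).
Proof.
rewrite -sum1_card -(pair_big_dep xpredT (fun i j : 'I_r => (i < j)%N) (fun _ _ => 1%N)) /=.
rewrite (exchange_big_dep xpredT) //= -bin2_sum big_mkord; apply: eq_bigr => j _.
rewrite -(big_ord_widen _ (fun=> 1%N)) ?sum1_card ?card_ord //.
exact/ltnW/ltn_ord.
Qed.

Lemma size_filter_enum (T : finType) (P : pred T) :
  size [seq x <- enum T | P x] = #|P|.
Proof.
rewrite cardE; apply: perm_size; apply: uniq_perm => [||x].
- exact/filter_uniq/enum_uniq.
- exact: enum_uniq.
by rewrite mem_filter !mem_enum andbT.
Qed.

Section Counting.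
Variables (A : 'M[nat]_(1, 3)) (g : 'I_3 -> 'cV[int]_3).
Hypothesis A_gt0 : forall j, (0 < A ord0 j)%N.
Hypothesis hg : herzog_basis A g.
Variable r : nat.

Lemma graver_move_row (i j : 'I_r) h k : submxcol (graver_move i j h) k =
  (if k == i then h else 0) - (if k == j then h else 0) :> 'cV[int]_3.
Proof. by rewrite submxcolB !submxcol_at_row. Qed.

Lemma graver_move_eq (i j i' j' : 'I_r) (h h' : 'cV[int]_3) :
  i != j -> i' != j' -> h <> 0 -> h' <> 0 ->
  graver_move i j h = graver_move i' j' h' ->
  [/\ i = i', j = j' & h = h'] \/ [/\ i = j', j = i' & h = - h'].
Proof.
move=> ij ij' h0 h0' E.
have row k : (if k == i then h else 0) - (if k == j then h else 0) =
    (if k == i' then h' else 0) - (if k == j' then h' else 0).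
  by rewrite -!graver_move_row E.
have ji' : j' != i' by rewrite eq_sym.
have := row i'; have := row j'; rewrite !eqxx (negPf ij') (negPf ji') subr0 sub0r.
have notN : 0 <> - h' by move=> /esym/eqP; rewrite oppr_eq0 => /eqP.
have [Ei|Ni] := eqVneq i' i; have [Ej|Nj] := eqVneq j' j => /=.
- by subst i' j'; rewrite (negPf ij) subr0 => _ ->; left.
- subst i'; have [E2|N2] := eqVneq j' i; first by subst j'; rewrite eqxx in ij'.
  by rewrite /= !subr0 => /notN.
- subst j'; have [E2|N2] := eqVneq i' j; first by subst i'; rewrite eqxx in ij'.
  by rewrite /= !subr0 => _ /esym.
have [E1|N1] := eqVneq i' j; last by rewrite /= !subr0 => _ /esym.
have [E2|N2] := eqVneq j' i; last by rewrite /= !subr0 => /notN.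
by rewrite subr0 => -> _; right; subst.
Qed.

Lemma herzog_inj : injective g.
Proof.
move=> a b gab; apply/eqP/negPn/negP => ab.
have := herzog_pos hg ab; rewrite gab; have := herzog_neg hg b; lia.
Qed.

Lemma herzog_neqN a b : g a <> - g b.
Proof.
move=> gab; have [c cN] : exists c, c != a /\ c != b.
  have [->|ab] := eqVneq a b.
    by have [c [d [bc _ _]]] := ord3_others b; exists c; rewrite eq_sym bc.
  by have [c ac bc] := ord3_third ab; exists c; rewrite eq_sym ac eq_sym bc.
have [ca cb] := cN; have := congr1 (fun v : 'cV[int]_3 => v c 0) gab; rewrite mxE => E.
have ac : a != c by rewrite eq_sym.
have bc : b != c by rewrite eq_sym.
have := herzog_pos hg ac; rewrite E oppr_gt0 => /(lt_trans (herzog_pos hg bc)).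
by rewrite ltxx.
Qed.

Lemma herzog_neq0 a : g a <> 0.
Proof. by move=> ga0; have := herzog_neg hg a; rewrite ga0 mxE ltxx. Qed.

Lemma herzog_move_row (f f' : 'I_3 -> 'I_r) (s : int) a : injective f -> injective f' ->
  herzog_move g f = s *: herzog_move g f' -> exists2 b, f a = f' b & g a = s *: g b.
Proof.
move=> finj finj' E.
have Ea : g a = s *: submxcol (herzog_move g f') (f a).
  have := congr1 (fun v => submxcol v (f a)) E; rewrite submxcol_selection // => ->.
  by apply/matrixP => p q; rewrite !mxE.
have [[b fb]|nb] := pselect (exists b, f a = f' b).
  by exists b; rewrite // Ea fb submxcol_selection.
case: (@herzog_neq0 a); rewrite Ea submxcol_selection0 ?scaler0 // => b.
by apply/eqP => fb; apply: nb; exists b.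
Qed.

Lemma herzog_move_inj (f f' : 'I_3 -> 'I_r) : injective f -> injective f' ->
  herzog_move g f = herzog_move g f' -> f =1 f'.
Proof.
move=> finj finj' E a; have [|b fb] := @herzog_move_row f f' 1 a finj finj'.
  by rewrite scale1r.
by rewrite scale1r => /herzog_inj ab; rewrite fb ab.
Qed.

Lemma herzog_move_neqN (f f' : 'I_3 -> 'I_r) : injective f -> injective f' ->
  herzog_move g f <> - herzog_move g f'.
Proof.
move=> finj finj' E; have [|b _] := @herzog_move_row f f' (-1) ord0 finj finj'.
  by rewrite scaleN1r.
by rewrite scaleN1r => /herzog_neqN.
Qed.

Variable reps : seq 'cV[int]_3.
Hypothesis reps_uniq : uniq reps.
Hypothesis reps_reduced : sign_reduced reps.
Hypothesis reps_graver : forall h, h \in reps -> graver_basis A h.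
Hypothesis graver_reps : forall h, graver_basis A h -> h \in reps \/ - h \in reps.

Definition ltn_pairs : seq ('I_r * 'I_r) :=
  [seq p : 'I_r * 'I_r <- enum {: 'I_r * 'I_r} | (p.1 < p.2)%N].
Definition injections : seq {ffun 'I_3 -> 'I_r} :=
  [seq f : {ffun 'I_3 -> 'I_r} <- enum {: {ffun 'I_3 -> 'I_r}} | injectiveb f].
Definition graver_moves : seq 'cV[int]_(\sum_(i < r) 3) :=
  [seq graver_move p.1 p.2 h | p <- ltn_pairs, h <- reps].
Definition herzog_moves : seq 'cV[int]_(\sum_(i < r) 3) :=
  [seq herzog_move g f | f : {ffun 'I_3 -> 'I_r} <- injections].
Definition lawrence_moves := graver_moves ++ herzog_moves.

Lemma ltn_pairsP (p : 'I_r * 'I_r) : p \in ltn_pairs -> (p.1 < p.2)%N.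
Proof. by rewrite mem_filter => /andP[]. Qed.

Lemma graver_movesP v : v \in graver_moves -> exists (i j : 'I_r) (h : 'cV[int]_3),
  [/\ (i < j)%N, i != j, h \in reps & v = graver_move i j h].
Proof.
case/allpairsP => -[[i j] h] /= [/ltn_pairsP ij hR ->]; exists i, j, h; split=> //.
by rewrite -val_eqE neq_ltn ij.
Qed.

Lemma herzog_movesP v : v \in herzog_moves -> exists2 f, injective f & v = herzog_move g f.
Proof.
case/mapP => f; rewrite mem_filter => /andP[/injectiveP finj _] ->.
by exists f.
Qed.

Lemma reps_neq0 h : h \in reps -> h <> 0.
Proof. by case/reps_graver. Qed.

Lemma graver_moves_type v : v \in graver_moves -> @lawrence_type r 3 v = 2%N.
Proof.
by case/graver_movesP => i [j [h [_ ij /reps_neq0 h0 ->]]]; exact: lawrence_type_graver.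
Qed.

Lemma herzog_moves_type v : v \in herzog_moves -> @lawrence_type r 3 v = 3%N.
Proof. by case/herzog_movesP => f finj ->; exact: (lawrence_type_herzog hg). Qed.

Lemma graver_moves_inj (p q : 'I_r * 'I_r) (h h' : 'cV[int]_3) :
  (p.1 < p.2)%N -> (q.1 < q.2)%N -> h \in reps -> h' \in reps ->
  graver_move p.1 p.2 h = graver_move q.1 q.2 h' \/
  graver_move p.1 p.2 h = - graver_move q.1 q.2 h' -> p = q /\ h = h'.
Proof.
case: p q => [i j] [i' j'] /= ij ij' hR hR'.
have nij : i != j by rewrite -val_eqE neq_ltn ij.
have nij' : i' != j' by rewrite -val_eqE neq_ltn ij'.
have nji' : j' != i' by rewrite eq_sym.
have [h0 h0'] := (reps_neq0 hR, reps_neq0 hR').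
case=> [|]; rewrite ?graver_moveN; move/graver_move_eq => [] // [? ? hh]; subst.
- by [].
- by have := ltn_trans ij ij'; rewrite ltnn.
- by have := ltn_trans ij ij'; rewrite ltnn.
by split=> //; apply: reps_reduced => //; right.
Qed.

Lemma lawrence_moves_uniq : uniq lawrence_moves.
Proof.
rewrite cat_uniq; apply/and3P; split.
- apply: allpairs_uniq => //; first exact/filter_uniq/enum_uniq.
  move=> [p h] [q h'] /allpairsP[[p1 h1] /= [/ltn_pairsP pP hR [-> ->]]].
  move=> /allpairsP[[q1 h2] /= [/ltn_pairsP qP hR' [-> ->]]] E.
  by have [-> ->] := graver_moves_inj pP qP hR hR' (or_introl E).
- apply/hasPn => v /herzog_moves_type v3; apply/negP => /graver_moves_type.
  by rewrite v3.
rewrite map_inj_in_uniq; first exact/filter_uniq/enum_uniq.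
move=> f f'; rewrite !mem_filter => /andP[/injectiveP fi _] /andP[/injectiveP fi' _].
by move/(herzog_move_inj fi fi') => E; apply/ffunP.
Qed.

(** The type separates the two families of moves; inside the first one the order
    i < j of the rows fixes the sign, inside the second one no g_a is opposite to
    a g_b. *)
Lemma lawrence_moves_reduced : sign_reduced lawrence_moves.
Proof.
move=> v w; rewrite !mem_cat => vR wR vw.
have tvw : @lawrence_type r 3 w = @lawrence_type r 3 v.
  by case: vw => ->; rewrite ?lawrence_typeN.
case/orP: vR tvw => vR; case/orP: wR => wR.
- move=> _; have [i [j [h [ij _ hR vE]]]] := graver_movesP vR.
  have [i' [j' [h' [ij' _ hR' wE]]]] := graver_movesP wR.
  rewrite vE wE in vw *.
  by have [[-> ->] ->] := @graver_moves_inj (i', j') (i, j) h' h ij' ij hR' hR vw.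
- by rewrite (graver_moves_type vR) (herzog_moves_type wR).
- by rewrite (graver_moves_type wR) (herzog_moves_type vR).
move=> _; have [f fi vE] := herzog_movesP vR; have [f' fi' wE] := herzog_movesP wR.
rewrite vE wE in vw *; case: vw => // /herzog_move_neqN.
by case.
Qed.

Lemma size_lawrence_moves : size lawrence_moves = (size reps * 'C(r, 2) + 6 * 'C(r, 3))%N.
Proof.
rewrite size_cat size_allpairs size_map mulnC !size_filter_enum; congr (_ * _ + _)%N.
  exact: card_ltn_pairs.
have := card_inj_ffuns 'I_3 'I_r; rewrite !card_ord -bin_ffact mulnC => <-.
by apply: eq_card => f; rewrite inE.
Qed.

Definition lawrence_basis : {fset 'cV[int]_(\sum_(i < r) 3)} := seq_fset tt lawrence_moves.

Lemma signed_mem_graver i j h : i != j -> graver_basis A h ->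
  signed_mem lawrence_basis (graver_move i j h).
Proof.
have lt (i' j' : 'I_r) (h' : 'cV[int]_3) : (i' < j')%N -> h' \in reps ->
    graver_move i' j' h' \in lawrence_basis.
  move=> ij hR; rewrite seq_fsetE mem_cat; apply/orP; left.
  apply/allpairsP; exists ((i', j'), h'); split=> //.
  by rewrite mem_filter /= ij mem_enum.
have neg (i' j' : 'I_r) (h' : 'cV[int]_3) : - graver_move i' j' h' = graver_move i' j' (- h').
  by rewrite /graver_move !at_rowN opprB opprK addrC.
move=> ij /graver_reps[hR|hR]; case: (ltngtP i j) => [lij|lij|/val_inj ijE].
- by left; exact: lt.
- by right; rewrite graver_moveN; exact: lt.
- by rewrite ijE eqxx in ij.
- by right; rewrite neg; exact: lt.
- by left; rewrite -[X in X \in _]opprK neg graver_moveN; exact: lt.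
- by rewrite ijE eqxx in ij.
Qed.

Lemma signed_mem_herzog (f : 'I_3 -> 'I_r) : injective f ->
  signed_mem lawrence_basis (herzog_move g f).
Proof.
move=> finj; left; rewrite seq_fsetE mem_cat; apply/orP; right.
have -> : herzog_move g f = herzog_move g [ffun a => f a].
  by apply: eq_bigr => a _; rewrite ffunE.
apply: map_f; rewrite mem_filter mem_enum andbT; apply/injectiveP => a b.
by rewrite !ffunE => /finj.
Qed.

Lemma lawrence_basisP v : v \in lawrence_basis ->
  (exists (i j : 'I_r) (h : 'cV[int]_3), [/\ i != j, graver_basis A h & v = graver_move i j h]) \/
  (exists2 f, injective f & v = herzog_move g f).
Proof.
rewrite seq_fsetE mem_cat => /orP[/graver_movesP|/herzog_movesP]; last by right.
by case=> i [j [h [_ ij /reps_graver Gh ->]]]; left; exists i, j, h.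
Qed.

Lemma markov_lawrence_basis : markov_basis (lawrence A r) lawrence_basis.
Proof.
apply: (markov_lawrence A_gt0 hg signed_mem_graver signed_mem_herzog) => v.
move/lawrence_basisP => [[i [j [h [ij [Ah _ _] ->]]]]|[f fi ->]].
  exact: lattice_graver_move.
exact: lattice_herzog_move.
Qed.

Lemma universal_lawrence :
  universal_markov (lawrence A r) = sign_closure [set` lawrence_basis]%classic /\
  indispensable (lawrence A r) = sign_closure [set` lawrence_basis]%classic.
Proof.
apply: universal_indispensableE markov_lawrence_basis _ _.
  move=> M v MD /lawrence_basisP[[i [j [h [ij Gh ->]]]]|[f fi ->]].
    exact: (graver_move_indispensable A_gt0 MD).
  exact: (herzog_move_indispensable A_gt0 hg MD).
move=> v; rewrite !seq_fsetE => vR vR'; apply/esym.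
by apply: lawrence_moves_reduced => //; right.
Qed.

Lemma card_universal_lawrence :
  card_up_to_sign (universal_markov (lawrence A r)) (size reps * 'C(r, 2) + 6 * 'C(r, 3)).
Proof.
rewrite universal_lawrence.1 -size_lawrence_moves.
apply: card_up_to_sign_seq lawrence_moves_uniq lawrence_moves_reduced _ _ => v.
  by move=> vR; left; rewrite /mkset seq_fsetE.
by case; rewrite /mkset seq_fsetE; [left|right].
Qed.

Lemma universal_type u : universal_markov (lawrence A r) u -> (@lawrence_type r 3 u <= 3)%N.
Proof.
rewrite universal_lawrence.1.
have le v : v \in lawrence_basis -> (@lawrence_type r 3 v <= 3)%N.
  by rewrite seq_fsetE mem_cat => /orP[/graver_moves_type->|/herzog_moves_type->].
by case=> /le; rewrite ?lawrence_typeN.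
Qed.

End Counting.

Lemma graver_representatives (A : 'M[nat]_(1, 3)) : (forall j, 0 < A ord0 j)%N ->
  exists reps : seq 'cV[int]_3, [/\ uniq reps, sign_reduced reps,
    forall h, h \in reps -> graver_basis A h
    & forall h, graver_basis A h -> h \in reps \/ - h \in reps].
Proof.
move=> A_gt0; have /finite_fsetP[G GE] := graver_finite A_gt0.
have GP h : graver_basis A h <-> h \in G by rewrite GE.
exists [seq h <- G | sign_rep h]; split.
- exact/filter_uniq/fset_uniq.
- move=> v w; rewrite !mem_filter => /andP[rv _] /andP[rw _] [//|wv].
  by rewrite wv in rw *; apply/esym/sign_rep_inj.
- by move=> h; rewrite mem_filter => /andP[_ /GP].
move=> h Gh; have /GP hG := Gh; have /GP hG' := graverN Gh.
by have /orP[hr|hr] := sign_repP h; [left|right]; rewrite mem_filter hr.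
Qed.

Local Open Scope nat_scope.

Theorem theorem2p6 (K : fieldType) (n1 n2 n3 : nat)
  (hpos : [/\ 0 < n1, 0 < n2 & 0 < n3])
  (hdist : [/\ n1 <> n2, n1 <> n3 & n2 <> n3])
  (hgcd : gcdn n1 (gcdn n2 n3) = 1)
  (hnci : ~ complete_intersection3 K (row3 n1 n2 n3)) :
  markov_complexity_is (row3 n1 n2 n3) 3 /\
  exists k : nat, card_up_to_sign (graver_basis (row3 n1 n2 n3)) k /\
    forall r : nat, 3 <= r ->
      universal_markov (lawrence (row3 n1 n2 n3) r)
        = indispensable (lawrence (row3 n1 n2 n3) r) /\
      card_up_to_sign (universal_markov (lawrence (row3 n1 n2 n3) r))
        (k * 'C(r, 2) + 6 * 'C(r, 3)).
Proof.
set A := row3 n1 n2 n3 in hnci *.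
have A_gt0 j : 0 < A ord0 j.
  by rewrite mxE; case: hpos => ? ? ?; case: j => [[|[|[|]]]].
have [g hg] := herzog_basis_exists A_gt0 hnci.
have [reps [reps_uniq reps_reduced reps_graver graver_reps]] := graver_representatives A_gt0.
split.
  split=> [|r _ u]; last exact: (universal_type A_gt0 hg reps_reduced reps_graver graver_reps).
  (* type 3 is attained at r = 3 by the matrix with rows g_1, g_2, g_3 *)
  exists 3; split=> //; exists (herzog_move g id).
    rewrite (universal_lawrence A_gt0 hg 3 reps_reduced reps_graver graver_reps).1.
    exact: signed_mem_herzog.
  exact: (lawrence_type_herzog hg).
exists (size reps); split; first exact: card_up_to_sign_seq.
move=> r _; split; last first.
  exact: (card_universal_lawrence A_gt0 hg r reps_uniq reps_reduced reps_graver graver_reps).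
by have [-> ->] := universal_lawrence A_gt0 hg r reps_reduced reps_graver graver_reps.
Qed.
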